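(* The functions $w_n$, $q_{r_0^n}$, $q_{l_0^n}$ ($n\ge3$) have the following explicit formulas for $-1\le t\le1$. For every integer $n\ge1$, $$w_{2n+1}(t)=-(1+\alpha(2n+1)t^2)\,|t|\,t^{2n-2}+\alpha(2n+1)f^0_{n,n}(t)+f^0_{n-1,n}(t),$$ $$w_{2n+2}(t)=-(1+\alpha(2n+2)t^2)\,|t|\,t^{2n-1}+\alpha(2n+2)f^1_{n,n}(t)+f^1_{n-1,n}(t),$$ and, for every integer $n\ge3$, $$q_{l_0^n}(-t)=q_{r_0^n}(t)=\frac{2(2n+1)!!}{(n+2)!}(1+t)\,p^{1,2}_{n-1}(t)-\frac{\langle w_n,r_0^n\rangle}{\langle w_n,w_n\rangle}\,w_n(t),\qquad -1\le t\le1,$$ with $$\frac{\langle w_n,r_0^n\rangle}{\langle w_n,w_n\rangle}=2^{n-2}\,\frac{(n-1)\left((n+1)(2n-3)-\sqrt3\,\sqrt{(2n+1)(2n-3)(n-1)(n+1)}\right)}{(n+1)(n+2)} .$$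
   Context: $(a)_0=1$, $(a)_j=a(a+1)\cdots(a+j-1)$; ${}_pF_q\left({a_1,\dots,a_p\atop b_1,\dots,b_q};t\right)=\sum_{i\ge0}\frac{(a_1)_i\cdots(a_p)_i}{(b_1)_i\cdots(b_q)_i\,i!}t^i$. $\langle f,g\rangle=\int_{-1}^1 f(t)g(t)\,dt$. $p_n^{\alpha,\beta}$ is the monic Jacobi polynomial of degree $n$, orthogonal on $[-1,1]$ with respect to $(1-x)^\alpha(1+x)^\beta$. For $N\ge2$, $P^N$ is the orthogonal projection of $L^2[-1,1]$ onto the polynomials of degree at most $N$ vanishing at $\pm1$. Set $r_0^N=(I-P^N)(1+t)$ and $l_0^N(t)=r_0^N(-t)$. On $[-1,1]$ let $\bar u_M(t)=1-|t|t^{M-1}$ for odd $M\ge1$, $\bar u_M(t)=t-|t|t^{M-1}$ for even $M\ge2$, and $u_{N,N-M}=(I-P^N)\bar u_M$. For integers $n\ge1$, $m\ge0$, $\epsilon\in\{0,1\}$, $$f^{\epsilon}_{m,n}(t)= t^{\epsilon}\,\frac{(\frac12+\epsilon)_{n}\,\bigl(n^2+(\frac32+\epsilon)n+m+1+\epsilon\bigr)\,(-m+\frac12)_{n}}{(m+1+\epsilon)_{n+1}\,(n+1)!}\;{}_4F_3\!\left({-n,\ -n^2-(\frac32+\epsilon)n-m-\epsilon,\ -m-\frac12,\ n+\frac32+\epsilon \atop \frac12+\epsilon,\ -n^2-(\frac32+\epsilon)n-m-1-\epsilon,\ -m+\frac12};\,t^2\right).$$ For $n\ge3$ define $w_n=\alpha(n)u_{n,0}+u_{n,2}$,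 where $$\alpha(n)=\frac{2}{n(2n-1)}\left(\frac{(n-2)(2n+1)}{n-1}-2\sqrt3\,\sqrt{\frac{(2n+1)(n+1)}{(2n-3)(n-1)}}\right).$$ Let $P_{w_n}$ be the orthogonal projection of $L^2[-1,1]$ onto the span of $w_n$, and set $q_{r_0^n}(t)=(I-P_{w_n})r_0^n(t)$, $q_{l_0^n}(t)=q_{r_0^n}(-t)$. *)

(* Defs.v *)
From HB Require Import structures.
From mathcomp Require Import all_boot all_order all_algebra.
From mathcomp Require Import all_classical all_reals all_analysis.

Set Implicit Arguments.
Unset Strict Implicit.
Unset Printing Implicit Defensive.

Import Order.TTheory GRing.Theory Num.Theory.
Import numFieldNormedType.Exports.

Local Open Scope classical_set_scope.
Local Open Scope ring_scope.

Fixpoint double_factorial (n : nat) : nat :=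
  if n is k.+2 then (n * double_factorial k)%N else 1%N.

Section Definitions.
Context {R : realType}.
Implicit Types (a b c s t x : R) (f g h v : R -> R) (m n M N j e : nat).

Definition pochhammer a j : R := \prod_(i < j) (a + i%:R).

(* In the series used below some upper parameter is -n with n : nat, and the
   lower parameters that are negative integers are smaller than -n.  Hence the
   terms of index > n are 0 (possibly as 0 / 0 = 0), and those of index <= n
   have a nonzero denominator. *)
Definition hypergeometric (upper lower : seq R) t : R :=
  limn (series (fun i : nat =>
    (\prod_(a <- upper) pochhammer a i) /
    ((\prod_(b <- lower) pochhammer b i) * (i`!)%:R) * t ^+ i)).

(* Elements of L^2[-1,1] are represented by functions on R, of which only the
   values on [-1,1] matter. *)
Definition inner f g : R :=
  \int[lebesgue_measure]_(t in `[-1, 1]) (f t * g t).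

(* The point g of V such that f - g is orthogonal to V.  It is used for
   finite-dimensional spaces V of continuous functions, for which g exists and
   is unique as a function on [-1,1], not only almost everywhere. *)
Definition orthogonal_projection (V : set (R -> R)) f : R -> R :=
  xget (fun=> 0)
    [set g | V g /\ forall h, V h -> inner (fun t => f t - g t) h = 0].

(* Polynomials of degree at most N vanishing at 1 and -1. *)
Definition polys_vanishing_at_ends N : set (R -> R) :=
  [set horner p | p in [set p : {poly R} |
    [/\ (size p <= N.+1)%N, p.[1] = 0 & p.[-1] = 0]]].

Definition P N f : R -> R :=
  orthogonal_projection (polys_vanishing_at_ends N) f.

Definition line v : set (R -> R) :=
  [set (fun t => c * v t) | c in [set: R]].

Definition P_line v f : R -> R := orthogonal_projection (line v) f.

(* The monic polynomial of degree n orthogonal, with respect to the weight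
   (1-x)^a (1+x)^b, to all the polynomials of degree < n. *)
Definition monic_jacobi a b n : {poly R} :=
  xget 0 [set p : {poly R} |
    [/\ p \is monic, size p = n.+1 &
        forall q : {poly R}, (size q <= n)%N ->
          \int[lebesgue_measure]_(x in `[-1, 1])
            (p.[x] * q.[x] * ((1 - x) `^ a * (1 + x) `^ b)) = 0]].

Definition r0 N t : R := 1 + t - P N (fun s => 1 + s) t.

Definition ubar M t : R :=
  (if odd M then 1 else t) - `|t| * t ^+ M.-1.

(* [u N j] is u_{N,j}, built from ubar_M with M = N - j; hence j < N. *)
Definition u N j t : R := ubar (N - j) t - P N (ubar (N - j)) t.

(* [fpoly e m n] is f^e_{m,n}, for e = 0 or 1 and n >= 1. *)
Definition fpoly e m n t : R :=
  let E := e%:R : R in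
  let m' := m%:R : R in
  let n' := n%:R : R in
  t ^+ e *
  ((pochhammer (1 / 2 + E) n * (n' ^+ 2 + (3 / 2 + E) * n' + m' + 1 + E)
      * pochhammer (- m' + 1 / 2) n) /
   (pochhammer (m' + 1 + E) n.+1 * (n.+1 `!)%:R)) *
  hypergeometric
    [:: - n'; - n' ^+ 2 - (3 / 2 + E) * n' - m' - E; - m' - 1 / 2;
        n' + 3 / 2 + E]
    [:: 1 / 2 + E; - n' ^+ 2 - (3 / 2 + E) * n' - m' - 1 - E; - m' + 1 / 2]
    (t ^+ 2).

Definition alpha n : R :=
  let n' := n%:R : R in
  2 / (n' * (2 * n' - 1)) *
  ((n' - 2) * (2 * n' + 1) / (n' - 1)
   - 2 * Num.sqrt 3
     * Num.sqrt ((2 * n' + 1) * (n' + 1) / ((2 * n' - 3) * (n' - 1)))).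

Definition w n t : R := alpha n * u n 0 t + u n 2 t.

Definition q_r0 n t : R := r0 n t - P_line (w n) (r0 n) t.

Definition q_l0 n t : R := q_r0 n (- t).

End Definitions.

(* Main.v *)
(* Put b = e + 1/2 and s = m + 1/2.  Each function u_{N,j} is a residual
   f(t) - |t| t^(2m+e), where f(t) = sum_i c_i t^(2i+e) satisfies f(1) = 1 and
   the residual is orthogonal to the polynomials vanishing at 1 and -1.  With
     G(z) = sum_(i <= n) c_i / (z + b + i) - 1 / (z + s + b),
   which collects the inner products of the residual with the powers
   t^(2z+e), orthogonality says that G takes one value T at z = 0, ..., n, and
   f(1) = 1 says that G(z) = O(1/z^2) at infinity.  This forces
     G(z) = T - T (prod_(k <= n) (z - k)) (z + g)
              / ((prod_(i <= n) (z + b + i)) (z + s + b))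
   with g = n^2 + n + (n + 2) b + s, and the residues of G are the
   coefficients of the hypergeometric formula for f.  Evaluating G at the half
   integers m' + 1/2 gives the Gram matrix of the residuals, and T is the inner
   product of a residual with r_0.  The same partial fractions with nodes
   3 + i, in the variable (1 + t)/2, give the Jacobi polynomial and r_0. *)

Require Import Defs.
From mathcomp Require Import all_boot all_order all_algebra.
From mathcomp Require Import all_classical all_reals all_analysis.
From mathcomp Require Import ring lra zify.
Import Order.TTheory GRing.Theory Num.Theory.
Import numFieldNormedType.Exports.
Local Open Scope ring_scope.

Set Implicit Arguments.
Unset Strict Implicit.
Unset Printing Implicit Defensive.

(** * The inner product on continuous functions *)

Lemma continuous_integrable_itv {R : realType} (f : R -> R) (a b : R) :
  continuous f -> (@lebesgue_measure R).-integrable `[a, b] (EFin \o f).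
Proof.
move=> cf; apply: continuous_compact_integrable; first exact: segment_compact.
by apply: continuous_subspaceT => x; exact: cf.
Qed.

Lemma Rintegral_deriv {R : realType} (p : {poly R}) (a b : R) : a < b ->
  \int[lebesgue_measure]_(x in `[a, b]) p^`().[x] = p.[b] - p.[a].
Proof.
move=> ab; rewrite /Rintegral (@continuous_FTC2 _ _ (horner p))//.
- by apply: continuous_subspaceT => x; exact: continuous_horner.
- split.
  + by move=> x _; exact: derivable_horner.
  + by apply: cvg_at_right_filter; exact: continuous_horner.
  + by apply: cvg_at_left_filter; exact: continuous_horner.
- by move=> x _; rewrite derivE.
Qed.

(* The term i = 0 is p`_0 / 0 = 0. *)
Definition primitive {R : fieldType} (p : {poly R}) : {poly R} :=
  \poly_(i < (size p).+1) (p`_i.-1 / i%:R).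

Lemma deriv_primitive {R : numFieldType} (p : {poly R}) : (primitive p)^`() = p.
Proof.
apply/polyP => i; rewrite coef_deriv coef_poly ltnS.
case: ltnP => [_|pi] /=; last by rewrite mul0rn nth_default.
by rewrite -[LHS]mulr_natr divfK// pnatr_eq0.
Qed.

(** A primitive F of p is nondecreasing on [-1, 1] with equal values at both ends, hence constant
    there; a polynomial constant on an interval is constant, so p = F' = 0. *)
Lemma Rintegral_horner_eq0 {R : realType} (p : {poly R}) :
  (forall t, -1 <= t <= 1 -> 0 <= p.[t]) ->
  \int[lebesgue_measure]_(x in `[-1, 1]) p.[x] = 0 -> p = 0.
Proof.
move=> p_ge0; rewrite -[p]deriv_primitive; set F := primitive p.
rewrite Rintegral_deriv ?gtrN// => F1.
have Fc t : -1 < t < 1 -> F.[t] = F.[-1].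
  move=> /andP[t1 t2].
  have := Rintegral_deriv F t1; have := Rintegral_deriv F t2.
  rewrite deriv_primitive => h1 h2.
  have : 0 <= F.[1] - F.[t].
    rewrite -h1; apply: Rintegral_ge0 => x /=; rewrite in_itv/= => /andP[tx x1].
    by rewrite p_ge0// x1 (le_trans _ tx)// ltW.
  have : 0 <= F.[t] - F.[-1].
    rewrite -h2; apply: Rintegral_ge0 => x /=; rewrite in_itv/= => /andP[tx x1].
    by rewrite p_ge0// tx (le_trans x1)// ltW.
  lra.
suff -> : F = F.[-1]%:P by rewrite derivC.
apply/eqP; rewrite -subr_eq0; apply/negP => /negP D0.
set D := F - _ in D0.
(* The points 1 / (i + 2) lie in (-1, 1) and are distinct; there are [size D] of them, one more than
   the degree of D allows as roots. *)
pose rs := [seq (i.+2)%:R^-1 : R | i <- iota 0 (size D)].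
have /(max_poly_roots D0) : all (root D) rs.
  apply/allP => _ /mapP[i _ ->]; rewrite /root /D hornerD hornerN hornerC Fc ?subrr//.
  by rewrite invf_lt1// ?ltr1n ?ltr0n// (lt_trans (ltrN10 _)) ?invr_gt0 ?ltr0n.
rewrite size_map size_iota ltnn => h; apply/notF/h.
rewrite map_inj_uniq ?iota_uniq// => i j /invr_inj/eqP.
by rewrite eqr_nat => /eqP[].
Qed.

Section Inner.
Context {R : realType}.
Implicit Types f g h : R -> R.

Lemma continuous_Xn k : continuous (fun t : R => t ^+ k).
Proof. exact: exprn_continuous. Qed.

Lemma continuous_normXn k : continuous (fun t : R => `|t| * t ^+ k).
Proof. by move=> x; apply: continuousM; [exact: norm_continuous|exact: exprn_continuous]. Qed.

Lemma continuousBf f g : continuous f -> continuous g -> continuous (fun t => f t - g t).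
Proof. by move=> cf cg x; apply: continuousB; [exact: cf|exact: cg]. Qed.

Lemma continuousDf f g : continuous f -> continuous g -> continuous (fun t => f t + g t).
Proof. by move=> cf cg x; apply: continuousD; [exact: cf|exact: cg]. Qed.

Lemma continuousMf f g : continuous f -> continuous g -> continuous (fun t => f t * g t).
Proof. by move=> cf cg x; apply: continuousM; [exact: cf|exact: cg]. Qed.

Lemma continuousZf (a : R) f : continuous f -> continuous (fun t => a * f t).
Proof. by move=> cf x; apply: continuousM; [exact: cst_continuous|exact: cf]. Qed.

Lemma innerC f g : inner f g = inner g f.
Proof. by rewrite /inner; apply: eq_Rintegral => x _; rewrite mulrC. Qed.

Lemma innerDl f g h : continuous f -> continuous g -> continuous h ->
  inner (fun t => f t + g t) h = inner f h + inner g h.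
Proof.
move=> cf cg ch; rewrite /inner -RintegralD//;
  try by apply: continuous_integrable_itv; exact: continuousMf.
by apply: eq_Rintegral => x _; rewrite mulrDl.
Qed.

Lemma innerZl (a : R) f h : continuous f -> continuous h ->
  inner (fun t => a * f t) h = a * inner f h.
Proof.
move=> cf ch; rewrite /inner -RintegralZl//.
- by apply: eq_Rintegral => x _; rewrite mulrA.
- by apply: continuous_integrable_itv; exact: continuousMf.
Qed.

Lemma innerBl f g h : continuous f -> continuous g -> continuous h ->
  inner (fun t => f t - g t) h = inner f h - inner g h.
Proof.
move=> cf cg ch; rewrite -[- inner g h]mulN1r -innerZl// -innerDl//.
  by congr inner; apply/funext => x; rewrite mulN1r.
exact: continuousZf.
Qed.

Lemma continuous_sum n (f : 'I_n -> R -> R) :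
  (forall i, continuous (f i)) -> continuous (fun t => \sum_(i < n) f i t).
Proof.
elim: n f => [|n IHn] f cf.
  by under eq_fun do rewrite big_ord0; move=> x; exact: cst_continuous.
under eq_fun do rewrite big_ord_recl.
by move=> x; apply: continuousD; [exact: cf|apply: IHn => i; exact: cf].
Qed.

Lemma inner_suml n (a : 'I_n -> R) (f : 'I_n -> R -> R) h :
    (forall i, continuous (f i)) -> continuous h ->
  inner (fun t => \sum_(i < n) a i * f i t) h = \sum_(i < n) a i * inner (f i) h.
Proof.
move=> + ch; elim: n a f => [|n IHn] a f cf.
  under eq_fun do rewrite big_ord0; rewrite big_ord0 /inner.
  under eq_Rintegral do rewrite mul0r.
  by rewrite Rintegral_cst// mul0r.
under eq_fun do rewrite big_ord_recl.
rewrite innerDl//; first last.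
- by apply: continuous_sum => i; apply: continuousZf.
- exact: continuousZf.
by rewrite big_ord_recl innerZl// IHn.
Qed.

Lemma deriv_Xn_scaled k : ((k.+1)%:R^-1 *: 'X^(k.+1) : {poly R})^`() = 'X^k.
Proof.
rewrite derivZ derivXn /= -scalerMnr scalerMnl -[_^-1 *+ _]mulr_natl.
by rewrite divff ?scale1r ?pnatr_eq0.
Qed.

Lemma inner_Xn_Xn i j : inner (fun t : R => t ^+ i) (fun t => t ^+ j) =
  if odd (i + j) then 0 else 2 / ((i + j).+1)%:R.
Proof.
rewrite /inner; have -> : (fun t : R => t ^+ i * t ^+ j) =
    (fun t => (((i + j).+1)%:R^-1 *: 'X^((i + j).+1) : {poly R})^`().[t]).
  by apply/funext => t; rewrite deriv_Xn_scaled hornerXn exprD.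
rewrite Rintegral_deriv ?gtrN// !hornerZ !hornerXn expr1n -signr_odd oddS.
by case: odd => /=; rewrite ?expr0 ?expr1; ring.
Qed.

Lemma inner_normXn_Xn i j : inner (fun t : R => `|t| * t ^+ i) (fun t => t ^+ j) =
  if odd (i + j) then 0 else 2 / ((i + j).+2)%:R.
Proof.
have ci : (@lebesgue_measure R).-integrable `[-1, 1]
    (EFin \o (fun t => `|t| * t ^+ i * t ^+ j)).
  apply: continuous_integrable_itv; apply: continuousMf.
  - exact: continuous_normXn.
  - exact: continuous_Xn.
set Q := (((i + j).+2)%:R^-1 *: 'X^((i + j).+2) : {poly R}).
(* The integral is cut at 0, where [|x|] changes from - x to x; each half is the integral of a
   polynomial derivative. *)
rewrite /inner -[LHS](subrK (\int[lebesgue_measure]_(x in `[-1, 0]) (`|x| * x ^+ i * x ^+ j))).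
rewrite Rintegral_itvB// ?bnd_simp//.
rewrite Rintegral_itv_obnd_cbnd; last first.
  by apply: integrableS ci => //; apply: subset_itv; rewrite bnd_simp.
have -> : \int[lebesgue_measure]_(x in `[0, 1]) (`|x| * x ^+ i * x ^+ j) =
    \int[lebesgue_measure]_(x in `[0, 1]) Q^`().[x].
  apply: eq_Rintegral => x; rewrite inE/= in_itv/= => /andP[x0 _].
  by rewrite ger0_norm// deriv_Xn_scaled hornerXn exprS exprD mulrA.
have -> : \int[lebesgue_measure]_(x in `[-1, 0]) (`|x| * x ^+ i * x ^+ j) =
    \int[lebesgue_measure]_(x in `[-1, 0]) (- Q)^`().[x].
  apply: eq_Rintegral => x; rewrite inE/= in_itv/= => /andP[_ x0].
  by rewrite ler0_norm// derivN hornerN deriv_Xn_scaled hornerXn exprS exprD mulrA !mulNr.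
rewrite !Rintegral_deriv ?ltrN10// !hornerN !hornerZ !hornerXn expr1n expr0n/=.
rewrite -signr_odd !oddS negbK.
by case: odd => /=; rewrite ?expr0 ?expr1; ring.
Qed.

Lemma inner_normXn_normXn i j :
  inner (fun t : R => `|t| * t ^+ i) (fun t => `|t| * t ^+ j) =
  if odd (i + j) then 0 else 2 / ((i + j).+3)%:R.
Proof.
transitivity (inner (fun t : R => t ^+ (i.+1)) (fun t => t ^+ (j.+1))); last first.
  by rewrite inner_Xn_Xn addSn addnS /= negbK.
apply: eq_Rintegral => t _; rewrite mulrACA -expr2 real_normK ?num_real//.
by rewrite expr2 !exprS mulrACA.
Qed.

End Inner.

(** * Orthogonal projections *)

Section Projection.
Context {R : realType}.
Implicit Types f g h : R -> R.

(** The difference of two candidates lies in V and is orthogonal to itself, so definiteness on V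
    makes the point chosen by [xget] unique. Definiteness gives equality on all of R, not only on
    [-1, 1]; polynomials and lines have it. *)
Lemma orthogonal_projectionE (V : set (R -> R)) f g :
    continuous f -> (forall h, V h -> continuous h) ->
    (forall h k, V h -> V k -> V (fun t => h t - k t)) ->
    (forall h, V h -> inner h h = 0 -> h = fun=> 0) ->
    V g -> (forall h, V h -> inner (fun t => f t - g t) h = 0) ->
  orthogonal_projection V f = g.
Proof.
move=> cf cV VB V0 Vg og; apply: xget_unique => // g' [Vg' og'].
apply/funext => t; apply/eqP; rewrite -subr_eq0.
suff d0 : (fun t => g' t - g t) = fun=> 0.
  by rewrite -[_ - _]/((fun t => g' t - g t) t) d0.
apply: V0; first exact: VB.
set d := fun t => g' t - g t.
have Vd : V d by exact: VB.
have -> : inner d d = inner (fun t => (f t - g t) - (f t - g' t)) d.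
  by congr inner; apply/funext => s; rewrite /d; ring.
rewrite innerBl; last exact: cV.
- by rewrite og// og'// subrr.
- by apply: continuousBf => //; exact: cV.
- by apply: continuousBf => //; exact: cV.
Qed.

Lemma inner_horner_eq0 (p : {poly R}) : inner (horner p) (horner p) = 0 -> p = 0.
Proof.
move=> pp; apply/eqP; suff : p ^+ 2 == 0 by rewrite expf_eq0.
apply/eqP/Rintegral_horner_eq0.
  by move=> t _; rewrite horner_exp sqr_ge0.
rewrite -[RHS]pp; apply: eq_Rintegral => t _.
by rewrite horner_exp expr2.
Qed.

Lemma projection_PE N f (p : {poly R}) : continuous f ->
    (size p <= N.+1)%N -> p.[1] = 0 -> p.[-1] = 0 ->
    (forall q : {poly R}, (size q <= N.+1)%N -> q.[1] = 0 -> q.[-1] = 0 ->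
      inner (fun t => f t - p.[t]) (horner q) = 0) ->
  P N f = horner p.
Proof.
move=> cf sp p1 pN1 orth; apply: orthogonal_projectionE => //.
- by move=> _ [q _ <-]; exact: continuous_horner.
- move=> _ _ [q [sq q1 qN1] <-] [r [sr r1 rN1] <-]; exists (q - r).
    split; last 2 first.
    + by rewrite hornerD hornerN q1 r1 subrr.
    + by rewrite hornerD hornerN qN1 rN1 subrr.
    by rewrite (leq_trans (size_polyD _ _))// geq_max size_polyN sq.
  by apply/funext => t; rewrite hornerD hornerN.
- by move=> _ [q _ <-] /inner_horner_eq0 ->; apply/funext => t; rewrite horner0.
- by exists p.
- by move=> _ [q [sq q1 qN1] <-]; exact: orth.
Qed.

Lemma P_lineE v f : continuous v -> continuous f -> inner v v != 0 ->
  P_line v f = fun t => inner v f / inner v v * v t.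
Proof.
move=> cv cf vv0; apply: orthogonal_projectionE => //.
- by move=> _ [c _ <-]; exact: continuousZf.
- move=> _ _ [c _ <-] [d _ <-]; exists (c - d) => //.
  by apply/funext => t; rewrite mulrBl.
- move=> _ [c _ <-]; rewrite innerZl//; last exact: continuousZf.
  rewrite innerC innerZl// => /eqP; rewrite !mulf_eq0 (negbTE vv0) orbF orbb.
  by move=> /eqP ->; apply/funext => t; rewrite mul0r.
- by eexists.
- move=> _ [c _ <-]; rewrite innerBl//; [|exact: continuousZf..].
  rewrite innerZl//; last exact: continuousZf.
  rewrite [inner f _]innerC [X in _ - _ * X]innerC !innerZl//.
  by rewrite mulrCA divfK// subrr.
Qed.

End Projection.

(** * Partial fractions *)

Section Lagrange.
Context {F : fieldType}.

Lemma size_prod_XsubC_neq n (y : 'I_n -> F) (i : 'I_n) :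
  size (\prod_(j < n | j != i) ('X - (y j)%:P)) = n.
Proof.
rewrite size_prod; last by move=> j _; rewrite polyXsubC_eq0.
under eq_bigr do rewrite size_XsubC.
rewrite sum_nat_const; have := cardC1 i; rewrite card_ord.
have -> : #|predC1 i| = #|(fun j : 'I_n => j != i)| by apply: eq_card => j.
by move=> ->; have := ltn_ord i; lia.
Qed.

(** The two sides agree at n distinct points, too many for a nonzero difference of degree below
    n. *)
Lemma lagrange_interpolation n (y : 'I_n -> F) (p : {poly F}) :
    injective y -> (size p <= n)%N ->
  p = \sum_(i < n) (p.[y i] / \prod_(j < n | j != i) (y i - y j)) *:
        \prod_(j < n | j != i) ('X - (y j)%:P).
Proof.
move=> yI sp; set q := \sum_(i < n) _.
have y0 i : \prod_(j < n | j != i) (y i - y j) != 0.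
  by apply/prodf_neq0 => j ji; rewrite subr_eq0 (inj_eq yI) eq_sym.
have sq : (size q <= n)%N.
  apply: (leq_trans (size_sum _ _ _)); apply/bigmax_leqP => i _.
  by rewrite (leq_trans (size_scale_leq _ _))// size_prod_XsubC_neq.
apply/eqP; rewrite -subr_eq0; apply/negP => /negP D0.
have /(max_poly_roots D0) : all (root (p - q)) [seq y i | i <- enum 'I_n].
  apply/allP => _ /mapP[i _ ->]; rewrite /root hornerD hornerN subr_eq0.
  rewrite /q horner_sum (bigD1 i)//= [X in _ + X]big1 ?addr0.
    rewrite hornerZ; have -> : (\prod_(j < n | j != i) ('X - (y j)%:P)).[y i] =
        \prod_(j < n | j != i) (y i - y j).
      by rewrite horner_prod; apply: eq_bigr => j _; rewrite hornerXsubC.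
    by rewrite divfK.
  move=> j ji; rewrite hornerZ horner_prod [X in _ * X](bigD1 i) 1?eq_sym//=.
  by rewrite hornerXsubC subrr mul0r mulr0.
rewrite map_inj_uniq// enum_uniq size_map size_enum_ord => /(_ isT).
by rewrite ltnNge (leq_trans (size_polyD _ _))// geq_max size_polyN sp.
Qed.

(** Each Lagrange basis product is monic of degree n - 1, so comparing the coefficients of that
    degree suffices. *)
Lemma lagrange_lead n (y : 'I_n -> F) (p : {poly F}) :
    injective y -> (size p <= n)%N ->
  \sum_(i < n) p.[y i] / \prod_(j < n | j != i) (y i - y j) = p`_n.-1.
Proof.
move=> yI sp; rewrite [in RHS](lagrange_interpolation yI sp) coef_sum.
apply: eq_bigr => i _; have := monicP (monic_prod_XsubC (index_enum 'I_n) (fun j => j != i) y).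
by rewrite lead_coefE size_prod_XsubC_neq coefZ => ->; rewrite mulr1.
Qed.

Lemma partial_fractions n (y : 'I_n -> F) (p : {poly F}) z :
    injective y -> (size p <= n)%N -> (forall i, z != y i) ->
  \sum_(i < n) p.[y i] / \prod_(j < n | j != i) (y i - y j) / (z - y i) =
  p.[z] / \prod_(i < n) (z - y i).
Proof.
move=> yI sp zy; rewrite {2}(lagrange_interpolation yI sp) horner_sum mulr_suml.
apply: eq_bigr => i _; rewrite hornerZ -!mulrA; congr (_ * (_ * _)).
rewrite horner_prod; under eq_bigr do rewrite hornerXsubC.
rewrite [X in _ / X](bigD1 i)//= invfM mulrCA mulfV ?mulr1//.
by apply/prodf_neq0 => j ji; rewrite subr_eq0.
Qed.

End Lagrange.

(** The coefficients of degree n + 1 are both 1, and those of degree n are minus the sums of the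
    roots; both pairs cancel. *)
Lemma size_sub_prod_XsubC {F : idomainType} (rs1 rs2 : seq F) n :
    size rs1 = n.+1 -> size rs2 = n.+1 ->
    \sum_(x <- rs1) x = \sum_(x <- rs2) x ->
  (size (\prod_(x <- rs1) ('X - x%:P) - \prod_(x <- rs2) ('X - x%:P))%R <= n)%N.
Proof.
move=> s1 s2 eq_sum; apply/leq_sizeP => j nj; rewrite coefB.
have c1 (rs : seq F) : size rs = n.+1 -> (\prod_(x <- rs) ('X - x%:P))`_n.+1 = 1.
  move=> srs; have := monicP (monic_prod_XsubC rs xpredT id).
  by rewrite lead_coefE size_prod_XsubC srs.
have c0 (rs : seq F) : size rs = n.+1 -> (\prod_(x <- rs) ('X - x%:P))`_n = - \sum_(x <- rs) x.
  by move=> srs; have := @coefPn_prod_XsubC _ rs; rewrite srs => /(_ isT).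
move: nj; rewrite leq_eqVlt => /orP[/eqP <-|]; first by rewrite !c0// eq_sum subrr.
rewrite leq_eqVlt => /orP[/eqP <-|nj]; first by rewrite !c1// subrr.
by rewrite !nth_default ?subr0// size_prod_XsubC ?s1 ?s2.
Qed.

(** * Partial fractions with poles in arithmetic progression *)

Section PartialFractions.
Context {R : realType}.
Implicit Types (b s z : R) (n i k : nat).

Lemma pochhammer0 b : pochhammer b 0 = 1.
Proof. by rewrite /pochhammer big_ord0. Qed.

Lemma pochhammerS b n : pochhammer b n.+1 = pochhammer b n * (b + n%:R).
Proof. by rewrite /pochhammer big_ord_recr. Qed.

Lemma pochhammerSl b n : pochhammer b n.+1 = b * pochhammer (b + 1) n.
Proof.
rewrite /pochhammer big_ord_recl addr0; congr (_ * _); apply: eq_bigr => i _.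
by rewrite /= /bump add1n -natr1; ring.
Qed.

Lemma pochhammer_gt0 b n : 0 < b -> 0 < pochhammer b n.
Proof. by move=> b0; apply: prodr_gt0 => i _; rewrite ltr_wpDr. Qed.

Lemma prod_oppr n (f : nat -> R) : \prod_(i < n) - f i = (-1) ^+ n * \prod_(i < n) f i.
Proof.
elim: n => [|n IHn]; first by rewrite !big_ord0 mulr1.
by rewrite !big_ord_recr /= IHn exprS; ring.
Qed.

(** The factors with j < i give (-1)^i i!, those with j > i give (n - i)!. *)
Lemma prod_subn_neq n (i : 'I_n.+1) :
  \prod_(j < n.+1 | j != i) (j%:R - i%:R) = (-1) ^+ i * i`!%:R * (n - i)`!%:R :> R.
Proof.
rewrite big_mkcond; case: i => i /= lti.
(* Comparing natural numbers instead of ordinals frees the condition from the bound n, as the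
   induction on n requires. *)
have -> : \prod_(j < n.+1) (if j != Ordinal lti then j%:R - i%:R else 1) =
          \prod_(j < n.+1) (if j != i :> nat then j%:R - i%:R else 1) :> R by [].
elim: n lti => [|n IHn].
  by case: i => // _; rewrite big_ord_recl big_ord0 /= !mulr1.
rewrite ltnS leq_eqVlt => /orP[/eqP ->|lti].
  rewrite big_ord_recr /= eqxx mulr1 subnn fact0 mulr1.
  transitivity (\prod_(j < n.+1) - (n.+1 - j)%:R : R).
    apply: eq_bigr => j _; have := ltn_ord j; rewrite ltnS => jn.
    by rewrite ifT ?natrB ?opprB// 1?ltnW ?ltnS// neq_ltn ltnS jn.
  rewrite (prod_oppr _ (fun j => (n.+1 - j)%:R)); congr (_ * _).
  rewrite -natr_prod; congr (_%:R); rewrite fact_prod big_add1 /= big_mkord.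
  rewrite (reindex_inj rev_ord_inj) /=; apply: eq_bigr => j _.
  by have /= := ltn_ord j; lia.
rewrite big_ord_recr /= IHn// ifT; last by rewrite neq_ltn lti orbT.
rewrite subSn// factS natrM -[(n - i).+1%:R]natr1 natrB// -[n.+1%:R]natr1.
by ring.
Qed.

(* The residue at - (b + i) of the fraction with numerator p and denominator
   the product of the z + b + j for j <= n. *)
Definition pf_coef b n (p : {poly R}) (i : nat) : R :=
  p.[- (b + i%:R)] / ((-1) ^+ i * i`!%:R * (n - i)`!%:R).

Lemma pf_coefE b n (p : {poly R}) (i : 'I_n.+1) :
  pf_coef b n p i =
  p.[- (b + i%:R)] / \prod_(j < n.+1 | j != i) (- (b + i%:R) - - (b + j%:R)).
Proof.
rewrite /pf_coef -prod_subn_neq; congr (_ / _).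
by apply: eq_bigr => j _; ring.
Qed.

Lemma node_inj b n : injective (fun i : 'I_n.+1 => - (b + i%:R)).
Proof. by move=> i j /oppr_inj/addrI/eqP; rewrite eqr_nat => /eqP/val_inj. Qed.

Lemma sum_pf_coef b n (p : {poly R}) : (size p <= n.+1)%N ->
  \sum_(i < n.+1) pf_coef b n p i = p`_n.
Proof.
by under eq_bigr do rewrite pf_coefE; move=> sp; rewrite (lagrange_lead (@node_inj b n)).
Qed.

Lemma sum_pf_coef_div b n (p : {poly R}) z : (size p <= n.+1)%N ->
    (forall i, z + (b + i%:R) != 0) ->
  \sum_(i < n.+1) pf_coef b n p i / (z + (b + i%:R)) =
  p.[z] / pochhammer (z + b) n.+1.
Proof.
move=> sp z0; pose y (i : 'I_n.+1) := - (b + i%:R).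
transitivity (\sum_(i < n.+1) p.[y i] / \prod_(j < n.+1 | j != i) (y i - y j) / (z - y i)).
  by apply: eq_bigr => i _; rewrite pf_coefE /y opprK.
rewrite partial_fractions//; first last.
- by move=> i; rewrite -subr_eq0 opprK.
- exact: node_inj.
by congr (_ / _); apply: eq_bigr => i _; rewrite opprK addrA.
Qed.

Lemma horner_prod_nodes b n z :
  (\prod_(i < n) ('X - (- (b + i%:R))%:P)).[z] = pochhammer (z + b) n.
Proof.
rewrite horner_prod; apply: eq_bigr => i _.
by rewrite hornerXsubC opprK addrA.
Qed.

Lemma horner_prod_subn n z :
  (\prod_(i < n) ('X - (i%:R)%:P)).[- z] = (-1) ^+ n * pochhammer z n :> R.
Proof.
rewrite horner_prod -(prod_oppr n (fun i => z + i%:R)).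
by apply: eq_bigr => i _; rewrite hornerXsubC opprD.
Qed.

Lemma pochhammerN_prod s n :
  pochhammer (- s) n = (-1) ^+ n * \prod_(i < n) (s - i%:R) :> R.
Proof.
by rewrite -(prod_oppr n (fun i => s - i%:R)); apply: eq_bigr => i _; rewrite opprB addrC.
Qed.

Definition falling s n : R := \prod_(i < n) (s - i%:R).

(* The value T of G at 0, ..., n. *)
Definition res_const b s n : R :=
  falling s n.+1 / pochhammer (s + b) n.+1 / ((n.+1)%:R * (n%:R + b)).

(* The number g: the zeros of G - T are 0, ..., n and -g. *)
Definition res_root b s n : R := n%:R ^+ 2 + n%:R + (n%:R + 2) * b + s.

(* Dividing by z + s + b leaves the numerator of G(z) + 1 / (z + s + b) over the
   product of the z + b + i. *)
Definition pf_num b s n : {poly R} :=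
  let A := \prod_(i < n.+1) ('X - (- (b + i%:R))%:P) in
  res_const b s n *: (('X + (s + b)%:P) * A -
    (\prod_(i < n.+1) ('X - (i%:R)%:P)) * ('X + (res_root b s n)%:P)) + A.

Lemma sum_natr n : \sum_(i < n.+1) i%:R = n%:R * (n%:R + 1) / 2 :> R.
Proof.
elim: n => [|n IHn]; first by rewrite big_ord_recl big_ord0 /= !mul0r addr0.
by rewrite big_ord_recr /= IHn -natr1; field.
Qed.

(** [res_root] is the number for which the two monic products of degree n + 2 have the same sum of
    roots. Their difference then has degree at most n, and the leading term of [pf_num] is that of
    A. This encodes the condition f(1) = 1. *)
Lemma pf_num_size b s n :
  (size (pf_num b s n) <= n.+2)%N /\ (pf_num b s n)`_n.+1 = 1.
Proof.
set A := \prod_(i < n.+1) ('X - (- (b + i%:R))%:P).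
have sA : size A = n.+2 by rewrite size_prod_XsubC [index_enum _]unlock -enumT size_enum_ord.
have mA : A`_n.+1 = 1.
  have := monicP (monic_prod_XsubC (index_enum 'I_n.+1) xpredT
    (fun i : 'I_n.+1 => - (b + i%:R))).
  by rewrite lead_coefE -/A sA.
set D := ('X + (s + b)%:P) * A -
    (\prod_(i < n.+1) ('X - (i%:R)%:P)) * ('X + (res_root b s n)%:P).
have sD : (size D <= n.+1)%N.
  have -> : D =
      \prod_(x <- rcons [seq - (b + i%:R) | i <- iota 0 n.+1] (- (s + b))) ('X - x%:P) -
      \prod_(x <- rcons [seq i%:R | i <- iota 0 n.+1] (- res_root b s n)) ('X - x%:P).
    rewrite -!cats1 !big_cat !big_seq1 !big_map.
    rewrite -![iota _ _]/(index_iota 0 n.+1) !big_mkord /= !polyCN !opprK -/A.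
    by rewrite mulrC.
  apply: size_sub_prod_XsubC; rewrite ?size_rcons ?size_map ?size_iota//.
  rewrite -!cats1 !big_cat !big_seq1 !big_map.
  rewrite -![iota _ _]/(index_iota 0 n.+1) !big_mkord /=
    sumrN big_split /= sumr_const card_ord.
  by rewrite sum_natr -[b *+ _]mulr_natr -natr1 /res_root; field.
rewrite /pf_num -/A -/D; split.
  have := size_polyD (res_const b s n *: D) A.
  move=> /leq_trans; apply; rewrite geq_max sA leqnn andbT.
  by apply: (leq_trans (size_scale_leq _ _)); apply: ltnW.
by rewrite coefD coefZ mA [D`_ _]nth_default ?mulr0 ?add0r.
Qed.

Definition res_poly b s n : {poly R} := pf_num b s n %/ ('X + (s + b)%:P).

(** These are the c_i of the idea above, the residues of G at - (b + i). *)
Definition res_coef b s n i : R := pf_coef b n (res_poly b s n) i.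

Lemma horner_pf_num b s n z : (pf_num b s n).[z] =
  res_const b s n * ((z + (s + b)) * pochhammer (z + b) n.+1 -
    (-1) ^+ n.+1 * pochhammer (- z) n.+1 * (z + res_root b s n))
  + pochhammer (z + b) n.+1.
Proof.
rewrite /pf_num !hornerE.
by rewrite horner_prod_nodes -[in X in _.[X] * _](opprK z) horner_prod_subn.
Qed.

(** * The case where s is not a natural number, so that - (s + b) differs from every node - (b +
    i) *)

Section NonResonant.
Variables (b s : R) (n : nat).
Hypotheses (b0 : 0 < b) (s0 : 0 < s) (sN : forall i : nat, s != i%:R).

Let sb0 : 0 < s + b. Proof. exact: addr_gt0. Qed.

Lemma falling_neq0 : falling s n.+1 != 0.
Proof. by apply/prodf_neq0 => i _; rewrite subr_eq0. Qed.

(** The value of [res_const] is what makes - (s + b) a root of [pf_num]: there g - s - b = (n + 1)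
    (n + b), and the two remaining terms cancel. This encodes that G has residue -1 at that
    point. *)
Lemma res_polyK : res_poly b s n * ('X + (s + b)%:P) = pf_num b s n.
Proof.
apply: divpK; rewrite -[_%:P]opprK -polyCN dvdp_XsubCl /root horner_pf_num.
rewrite addNr mul0r sub0r opprK opprD addrNK pochhammerN_prod -/(falling _ _).
rewrite /res_const /res_root -natr1; apply/eqP; field.
by rewrite natr1 pnatr_eq0 !gt_eqF ?pochhammer_gt0// ltr_wpDl.
Qed.

Lemma size_res_poly : (size (res_poly b s n) <= n.+1)%N.
Proof.
have := (pf_num_size b s n).1; rewrite -res_polyK.
have [->|H0] := eqVneq (res_poly b s n) 0; first by rewrite size_poly0.
by rewrite size_Mmonic ?monicXaddC// size_XaddC addn2.
Qed.

Lemma coef_res_poly : (res_poly b s n)`_n = 1.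
Proof.
have := (pf_num_size b s n).2; rewrite -res_polyK mulrDr coefD coefMX coefMC /=.
by rewrite [(res_poly _ _ _)`_n.+1]nth_default ?mul0r ?addr0// size_res_poly.
Qed.

Lemma sum_res_coef : \sum_(i < n.+1) res_coef b s n i = 1.
Proof. by rewrite -coef_res_poly; apply: sum_pf_coef size_res_poly. Qed.

(** The left side is G(z). In [pf_num] divided by both denominators, the summand A contributes 1 /
    (z + s + b), which cancels, and the rest is a multiple of T. *)
Lemma sum_res_coef_div z : 0 <= z ->
  \sum_(i < n.+1) res_coef b s n i / (z + (b + i%:R)) - (z + (s + b))^-1 =
  res_const b s n * (1 - falling z n.+1 * (z + res_root b s n) /
    (pochhammer (z + b) n.+1 * (z + (s + b)))).
Proof.
move=> z0; rewrite /res_coef (sum_pf_coef_div size_res_poly); last first.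
  by move=> i; rewrite gt_eqF// ltr_wpDl// ltr_wpDr.
have zsb : z + (s + b) != 0 by rewrite gt_eqF// ltr_wpDl.
have pz : pochhammer (z + b) n.+1 != 0 by rewrite gt_eqF// pochhammer_gt0// ltr_wpDl.
have -> : (res_poly b s n).[z] = (pf_num b s n).[z] / (z + (s + b)).
  by rewrite -res_polyK hornerM hornerD hornerX hornerC mulfK.
rewrite horner_pf_num pochhammerN_prod -/(falling _ _) mulrA -expr2 sqrr_sign mul1r.
by field; rewrite zsb.
Qed.

Lemma sum_res_coef_nat k : (k <= n)%N ->
  \sum_(i < n.+1) res_coef b s n i / (k%:R + (b + i%:R)) - (k%:R + (s + b))^-1 =
  res_const b s n.
Proof.
move=> kn; rewrite sum_res_coef_div//.
have -> : falling k%:R n.+1 = 0.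
  by rewrite /falling (bigD1 (Ordinal (kn : k < n.+1)%N))//= subrr mul0r.
by rewrite !mul0r subr0 mulr1.
Qed.

(** At the node - (b + i) the product A vanishes, so only the product of the z - k, times z + g, is
    left in [pf_num]. *)
Lemma res_coefE i : (i <= n)%N -> res_coef b s n i =
  res_const b s n * (-1) ^+ n * pochhammer (b + i%:R) n.+1 *
   (res_root b s n - b - i%:R) /
  ((s - i%:R) * ((-1) ^+ i * i`!%:R * (n - i)`!%:R)).
Proof.
move=> le_in.
have si : s - i%:R != 0 by rewrite subr_eq0.
have e : - (b + i%:R) + (s + b) = s - i%:R by ring.
rewrite /res_coef /pf_coef; have -> : (res_poly b s n).[- (b + i%:R)] =
    (pf_num b s n).[- (b + i%:R)] / (s - i%:R).
  by rewrite -res_polyK hornerM hornerD hornerX hornerC e mulfK.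
have p0 : pochhammer (- (b + i%:R) + b) n.+1 = 0.
  rewrite /pochhammer (bigD1 (Ordinal (le_in : i < n.+1)%N))//=.
  by rewrite (_ : _ + b + _ = 0) ?mul0r//; ring.
rewrite horner_pf_num p0 opprK exprS; field.
by rewrite si signr_eq0 !pnatr_eq0 -!lt0n !fact_gt0.
Qed.

End NonResonant.

End PartialFractions.

(** * The functions f and the residuals *)

Section Hypergeometric.
Context {R : realType}.
Implicit Types (a b s z t : R) (n i k m e : nat).

Lemma pochhammerD a m n : pochhammer a (m + n) = pochhammer a m * pochhammer (a + m%:R) n.
Proof.
elim: n => [|n IHn]; first by rewrite addn0 pochhammer0 mulr1.
by rewrite addnS !pochhammerS IHn -mulrA -addrA natrD.
Qed.

Lemma pochhammerNn_eq0 n i : (n < i)%N -> pochhammer (- n%:R) i = 0 :> R.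
Proof. by move=> ni; rewrite /pochhammer (bigD1 (Ordinal ni))//= addNr mul0r. Qed.

Lemma pochhammerNn n i : (i <= n)%N ->
  pochhammer (- n%:R) i = (-1) ^+ i * n`!%:R / (n - i)`!%:R :> R.
Proof.
move=> le_in; have f0 k : k`!%:R != 0 :> R by rewrite pnatr_eq0 -lt0n fact_gt0.
apply: (mulIf (f0 (n - i)%N)); rewrite divfK//.
elim: i le_in => [|i IHi] lt_in; first by rewrite pochhammer0 subn0.
rewrite exprS -mulrA -IHi 1?ltnW// pochhammerS.
rewrite -(subnSK lt_in) factS natrM subnSK// natrB 1?ltnW//; ring.
Qed.

(** The upper parameter - n kills every term of index above n, so the partial sums are constant from
    n + 1 on. *)
Lemma hypergeometric_terminating n us ls z :
  hypergeometric (- n%:R :: us) ls z =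
  \sum_(i < n.+1) (\prod_(a <- - n%:R :: us) pochhammer a i) /
    ((\prod_(b <- ls) pochhammer b i) * (i`!)%:R) * z ^+ i.
Proof.
rewrite /hypergeometric; apply: lim_near_cst => //.
exists n.+1 => // k /= nk; rewrite /series /= (@big_cat_nat _ _ _ n.+1)//= big_mkord.
rewrite [X in _ + X]big_nat_cond [X in _ + X]big1 ?addr0// => i.
rewrite andbT => /andP[ni _].
by rewrite big_cons pochhammerNn_eq0// !mul0r.
Qed.

Section Coefficients.
Variables (b s : R) (n : nat).
Hypotheses (b0 : 0 < b) (s0 : 0 < s) (sN : forall i : nat, s != i%:R).

(** Two pairs of parameters differ by 1, and their quotients telescope to (L - i) / L and s / (s -
    i), the linear factors of [res_coefE]. *)
Lemma res_coef_hypergeometric i : let L := res_root b s n - b in (i <= n)%N ->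
  (pochhammer b n * L * pochhammer (1 - s) n) /
    (pochhammer (s + b) n.+1 * (n.+1)`!%:R) *
  (pochhammer (- n%:R) i * pochhammer (1 - L) i * pochhammer (- s) i *
    pochhammer (n%:R + 1 + b) i /
   (pochhammer b i * pochhammer (- L) i * pochhammer (1 - s) i * i`!%:R)) =
  res_coef b s n i.
Proof.
move=> L le_in; rewrite res_coefE// pochhammerNn//.
(* L > n keeps the lower Pochhammer symbol (-L)_i away from 0 for i <= n. *)
have Ln : n%:R < L.
  rewrite /L /res_root; have : 0 <= n%:R ^+ 2 + n%:R * b :> R.
    by rewrite addr_ge0// ?sqr_ge0// mulr_ge0// ltW.
  move=> h; rewrite -subr_gt0 (_ : _ - _ = n%:R ^+ 2 + n%:R * b + (b + s)); last by ring.
  by rewrite ltr_wpDl// addr_gt0.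
have L0 : L != 0 by rewrite gt_eqF// (le_lt_trans _ Ln).
have pL0 : pochhammer (- L) i != 0.
  apply/prodf_neq0 => j _; rewrite lt_eqF// addrC subr_lt0 (le_lt_trans _ Ln)// ler_nat.
  by rewrite (leq_trans _ le_in)// ltnW.
have ps0 k : pochhammer (1 - s) k != 0.
  apply/prodf_neq0 => j _; rewrite addrAC subr_eq0 eq_sym.
  by have := sN j.+1; rewrite -natr1 addrC.
have si0 : s - i%:R != 0 by rewrite subr_eq0.
have bn0 : n%:R + b != 0 by rewrite gt_eqF// ltr_wpDl.
have eL : pochhammer (1 - L) i = pochhammer (- L) i * (L - i%:R) / L.
  apply: (mulIf L0); rewrite divfK// [1 - L]addrC.
  by have := pochhammerSl (- L) i; rewrite pochhammerS => h; lra.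
have es : pochhammer (- s) i = s * pochhammer (1 - s) i / (s - i%:R).
  apply: (mulIf si0); rewrite divfK// [1 - s]addrC.
  by have := pochhammerSl (- s) i; rewrite pochhammerS => h; lra.
(* Times (b)_n (n + b), both sides are (b)_(n+1+i), cut after n + 1 factors or after i factors. *)
have eb : pochhammer (n%:R + 1 + b) i =
    pochhammer b i * pochhammer (b + i%:R) n.+1 / (pochhammer b n * (n%:R + b)).
  have p0 : pochhammer b n * (n%:R + b) != 0 by rewrite mulf_neq0// gt_eqF// pochhammer_gt0.
  apply: (mulIf p0); rewrite divfK// -pochhammerD addnC pochhammerD pochhammerS.
  by rewrite natr1 [_ + b]addrC [b + n%:R]addrC mulrC.
have ef : falling s n.+1 = (-1) ^+ n * s * pochhammer (1 - s) n.
  have := pochhammerN_prod s n.+1; rewrite -/(falling _ _) pochhammerSl exprS.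
  rewrite [- s + 1]addrC => h.
  apply: (mulfI (negbT (signr_eq0 R n))); rewrite !mulrA -expr2 sqrr_sign mul1r.
  by move: h; rewrite mulN1r !mulNr => /oppr_inj.
rewrite eL es eb /res_const ef factS natrM -[(res_root _ _ _) - b]/L.
(* [field] does not know that signs square to 1, so one occurrence of (-1)^i here, and of (-1)^n
   below, is replaced by its inverse. *)
rewrite -{2}[(-1) ^+ i]invr_sign.
have sg : (-1) ^+ n * (-1) ^+ n = 1 :> R by rewrite -expr2 sqrr_sign.
have pb n' : pochhammer b n' != 0 by rewrite gt_eqF// pochhammer_gt0.
have psb : pochhammer (s + b) n.+1 != 0 by rewrite gt_eqF// pochhammer_gt0// addr_gt0.
have f0 k : k`!%:R != 0 :> R by rewrite pnatr_eq0 -lt0n fact_gt0.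
have n10 : n.+1%:R != 0 :> R by rewrite pnatr_eq0.
set u := (-1) ^+ n in sg *; set v := (-1) ^+ i.
have u0 : u != 0 by rewrite signr_eq0.
have v0 : v != 0 by rewrite signr_eq0.
have uE : u = u^-1 by rewrite /u invr_sign.
rewrite {1}uE; field.
by rewrite u0 v0 !f0 si0 bn0 addrC natr1 n10 psb ps0 pL0 !pb L0.
Qed.

End Coefficients.

Definition nhalf k : R := k%:R + 1 / 2.

Lemma nhalf_gt0 k : 0 < nhalf k.
Proof. by rewrite ltr_wpDl// divr_gt0. Qed.

Lemma nhalf_neq_nat k i : nhalf k != i%:R.
Proof.
rewrite /nhalf -(inj_eq (@mulIf _ 2 _))// mulrDl divfK// -!natrM natr1 eqr_nat.
by apply/negP => /eqP; lia.
Qed.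

(** With b = e + 1/2 and s = m + 1/2, the quadratic expression n^2 + (3/2 + e) n + m + 1 + e is L =
    g - b. *)
Lemma fpolyE e m n t :
  fpoly e m n t = \sum_(i < n.+1) res_coef (nhalf e) (nhalf m) n i * t ^+ (2 * i + e).
Proof.
rewrite /fpoly /= hypergeometric_terminating !mulr_sumr; apply: eq_bigr => i _.
rewrite -(res_coef_hypergeometric (nhalf_gt0 e) (nhalf_gt0 m) (@nhalf_neq_nat m)) -1?ltnS//.
set L := res_root (nhalf e) (nhalf m) n - nhalf e.
have eL : L = n%:R ^+ 2 + (3 / 2 + e%:R) * n%:R + m%:R + 1 + e%:R.
  by rewrite /L /res_root /nhalf; field.
rewrite !(big_cons, big_nil) !mulr1 exprD exprM.
rewrite (_ : 1 / 2 + e%:R = nhalf e); last exact: addrC.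
rewrite -eL (_ : - m%:R + 1 / 2 = 1 - nhalf m); last by rewrite /nhalf; field.
rewrite (_ : m%:R + 1 + e%:R = nhalf m + nhalf e); last by rewrite /nhalf; field.
rewrite (_ : - n%:R ^+ 2 - (3 / 2 + e%:R) * n%:R - m%:R - e%:R = 1 - L); last first.
  by rewrite eL; ring.
rewrite (_ : - n%:R ^+ 2 - (3 / 2 + e%:R) * n%:R - m%:R - 1 - e%:R = - L); last first.
  by rewrite eL; ring.
rewrite (_ : - m%:R - 1 / 2 = - nhalf m); last by rewrite /nhalf; ring.
rewrite (_ : n%:R + 3 / 2 + e%:R = n%:R + 1 + nhalf e); last by rewrite /nhalf; field.
rewrite -!mulrA; ring.
Qed.

Lemma fpoly_sum e m n : fpoly e m n =
  (fun t => \sum_(i < n.+1) res_coef (nhalf e) (nhalf m) n i * t ^+ (2 * i + e)).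
Proof. by apply/funext => t; exact: fpolyE. Qed.

End Hypergeometric.

(** * The residuals and their inner products *)

Section Residual.
Context {R : realType}.
Implicit Types (t : R) (n i k m e N : nat).

Definition residual e m n t : R := fpoly e m n t - `|t| * t ^+ (2 * m + e).

Definition fpolyp e m n : {poly R} :=
  \sum_(i < n.+1) res_coef (nhalf e) (nhalf m) n i *: 'X^(2 * i + e).

Lemma horner_fpolyp e m n t : (fpolyp e m n).[t] = fpoly e m n t.
Proof.
rewrite fpolyE horner_sum; apply: eq_bigr => i _.
by rewrite hornerZ hornerXn.
Qed.

Lemma size_fpolyp e m n : (size (fpolyp e m n) <= (2 * n + e).+1)%N.
Proof.
apply: (leq_trans (size_sum _ _ _)); apply/bigmax_leqP => i _.
rewrite (leq_trans (size_scale_leq _ _))// size_polyXn ltnS leq_add2r leq_mul2l.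
by rewrite -ltnS ltn_ord.
Qed.

Lemma fpoly1 e m n : fpoly e m n 1 = 1 :> R.
Proof.
rewrite fpolyE -[RHS](sum_res_coef n (nhalf_gt0 e) (nhalf_gt0 m)).
by apply: eq_bigr => i _; rewrite expr1n mulr1.
Qed.

Lemma fpolyN e m n t : fpoly e m n (- t) = (-1) ^+ e * fpoly e m n t.
Proof.
rewrite !fpolyE mulr_sumr; apply: eq_bigr => i _.
have sgn : (-1) ^+ (2 * i + e) = (-1) ^+ e :> R by rewrite exprD exprM sqrrN !expr1n mul1r.
by rewrite (exprNn t) sgn mulrCA.
Qed.

Lemma continuous_fpoly e m n : continuous (@fpoly R e m n).
Proof.
have -> : @fpoly R e m n = horner (fpolyp e m n).
  by apply/funext => t; rewrite horner_fpolyp.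
exact: continuous_horner.
Qed.

Lemma continuous_residual e m n : continuous (residual e m n).
Proof.
apply: continuousBf; first exact: continuous_fpoly.
exact: continuous_normXn.
Qed.

Lemma inner_fpolyl e m n (h : R -> R) : continuous h ->
  inner (fpoly e m n) h =
  \sum_(i < n.+1) res_coef (nhalf e) (nhalf m) n i * inner (fun t => t ^+ (2 * i + e)) h.
Proof.
move=> ch; rewrite fpoly_sum inner_suml// => i; exact: continuous_Xn.
Qed.

(** Turns the integral 2 / (2z + 2b + 2i) of a product of powers into the term 1 / (z + b + i) of
    G. *)
Lemma two_div (x y : R) : x * 2 = y -> 2 / y = x^-1.
Proof. by move=> <-; rewrite invfM mulrCA mulfV ?mulr1// pnatr_eq0. Qed.

(** For k = 2j + e the inner product is G(j), equal to T as j <= n; for the other parity the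
    integrand is odd. The top value k = 2n + e + 1 is of the other parity. *)
Lemma inner_residual_Xn e m n k : (k <= 2 * n + e.+1)%N -> (e <= 1)%N ->
  inner (residual e m n) (fun t => t ^+ k) =
  if odd (k + e) then 0 else res_const (nhalf e) (nhalf m) n.
Proof.
move=> kn e1; rewrite innerBl; last 3 first.
- exact: continuous_fpoly.
- exact: continuous_normXn.
- exact: continuous_Xn.
rewrite inner_fpolyl; last exact: continuous_Xn.
have odd_even j : odd (2 * j + e + k) = odd (k + e).
  by rewrite -addnA [(e + k)%N]addnC oddD oddM.
rewrite inner_normXn_Xn odd_even.
under eq_bigr do rewrite inner_Xn_Xn odd_even.
case: ifPn => [_|ke]; first by rewrite big1 ?subr0// => i _; rewrite mulr0.
have [j kj] : exists j, k = (2 * j + e)%N.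
  by exists ((k - e) %/ 2)%N; move: ke; lia.
have jn : (j <= n)%N by lia.
rewrite -(sum_res_coef_nat (nhalf_gt0 e) (nhalf_gt0 m) jn).
congr (_ - _); last first.
  by apply: two_div; rewrite kj /nhalf -[((_ + _).+2)%N]addn2 !(natrM, natrD); field.
apply: eq_bigr => i _; congr (_ * _); apply: two_div.
by rewrite kj /nhalf -[((_ + _).+1)%N]addn1 !(natrM, natrD); field.
Qed.

Lemma horner_continuous_sum (p : {poly R}) n : (size p <= n)%N ->
  horner p = fun t => \sum_(i < n) p`_i * t ^+ i.
Proof. by move=> sp; apply/funext => t; rewrite (horner_coef_wide _ sp). Qed.

(** The half sum on the right is the sum of the coefficients of p whose index has the parity of e.
    It is 0 when p vanishes at 1 and -1, which is the orthogonality wanted. *)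
Lemma inner_residual_horner e m n (p : {poly R}) :
    (size p <= (2 * n + e).+2)%N -> (e <= 1)%N ->
  inner (residual e m n) (horner p) =
  res_const (nhalf e) (nhalf m) n * ((p.[1] + (-1) ^+ e * p.[-1]) / 2).
Proof.
move=> sp e1; rewrite (horner_continuous_sum sp) innerC inner_suml; last 2 first.
- by move=> i; exact: continuous_Xn.
- exact: continuous_residual.
rewrite mulr_sumr -big_split /= mulr_suml mulr_sumr; apply: eq_bigr => i _.
rewrite innerC inner_residual_Xn//; last by have := ltn_ord i; lia.
rewrite expr1n [(-1) ^+ e * _]mulrCA -exprD [(e + i)%N]addnC -[(-1) ^+ (i + e)]signr_odd.
by case: odd; rewrite ?expr0 ?expr1; field.
Qed.

(** On [0, 1] the second function is t^(2z+e) with z = m' + 1/2, so by parity this is G(m' +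
    1/2). *)
Lemma inner_residual_normXn e m m' n : (e <= 1)%N ->
  inner (residual e m n) (fun t => `|t| * t ^+ (2 * m' + e)) =
  res_const (nhalf e) (nhalf m) n -
  res_const (nhalf e) (nhalf m) n * falling (nhalf m') n.+1 *
    (nhalf m' + res_root (nhalf e) (nhalf m) n) /
    (pochhammer (nhalf m' + nhalf e) n.+1 * (nhalf m' + (nhalf m + nhalf e))).
Proof.
move=> e1; rewrite innerBl; last 3 first.
- exact: continuous_fpoly.
- exact: continuous_normXn.
- exact: continuous_normXn.
rewrite inner_fpolyl; last exact: continuous_normXn.
have -> : forall T x y z : R, T - T * x * y / z = T * (1 - x * y / z) by move=> *; ring.
rewrite -(sum_res_coef_div n (nhalf_gt0 e) (nhalf_gt0 m) (ltW (nhalf_gt0 m'))).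
have odd_even j j' : odd (2 * j + e + (2 * j' + e)) = false by lia.
rewrite inner_normXn_normXn odd_even; congr (_ - _); last first.
  by apply: two_div; rewrite /nhalf -[((_ + _).+3)%N]addn3 !(natrM, natrD); field.
apply: eq_bigr => i _; congr (_ * _); rewrite innerC inner_normXn_Xn odd_even.
by apply: two_div; rewrite /nhalf -[((_ + _).+2)%N]addn2 !(natrM, natrD); field.
Qed.

(** The polynomial part of the second residual contributes T, since it is 1 at t = 1; this cancels
    the T in G(m' + 1/2). The falling product that remains is rewritten through the constant T of
    m', which makes the result a Gram entry. *)
Lemma inner_residual_residual e m m' n : (e <= 1)%N ->
  inner (residual e m n) (residual e m' n) =
  res_const (nhalf e) (nhalf m) n * res_const (nhalf e) (nhalf m') n *
    ((n.+1)%:R * (n%:R + nhalf e)) * (nhalf m' + res_root (nhalf e) (nhalf m) n) /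
    (nhalf m' + (nhalf m + nhalf e)).
Proof.
move=> e1; rewrite [LHS]innerC innerBl; last 3 first.
- exact: continuous_fpoly.
- exact: continuous_normXn.
- exact: continuous_residual.
have -> : @fpoly R e m' n = horner (fpolyp e m' n).
  by apply/funext => t; rewrite horner_fpolyp.
rewrite innerC inner_residual_horner//; last exact: leqW (size_fpolyp _ _ _).
rewrite !horner_fpolyp fpolyN fpoly1 mulr1 -expr2 sqrr_sign.
rewrite innerC inner_residual_normXn//.
rewrite [X in _ = _ * X * _ * _ / _]/res_const.
have hp k : 0 < nhalf k :> R by exact: nhalf_gt0.
field.
have -> : 1 + n%:R = n.+1%:R :> R by rewrite addrC natr1.
have h3 : 0 < n%:R + nhalf e :> R by rewrite ltr_wpDl.
have h4 i j : 0 < nhalf i + nhalf j :> R by exact: addr_gt0.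
have h5 : 0 < nhalf m' + (nhalf m + nhalf e) :> R by exact: addr_gt0.
by rewrite pnatr_eq0 !gt_eqF ?pochhammer_gt0.
Qed.

(** The projection is t^e - f(t): it vanishes at both ends because f(1) = 1 and f has the parity of
    e. *)
Lemma residual_proj e m n N : (e <= 1)%N -> (2 * n + e < N)%N -> (N <= (2 * n + e).+1)%N ->
  (fun t => t ^+ e - `|t| * t ^+ (2 * m + e) -
     P N (fun s => s ^+ e - `|s| * s ^+ (2 * m + e)) t) = residual e m n.
Proof.
move=> e1 nN Nn; apply/funext => t.
rewrite (@projection_PE _ _ _ ('X^e - fpolyp e m n)).
- by rewrite hornerD hornerN hornerXn horner_fpolyp /residual; ring.
- by apply: continuousBf; [exact: continuous_Xn|exact: continuous_normXn].
- rewrite (leq_trans (size_polyD _ _))// geq_max size_polyN size_polyXn.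
  by apply/andP; split; [|apply: leq_trans (size_fpolyp _ _ _) _]; lia.
- by rewrite hornerD hornerN hornerXn horner_fpolyp fpoly1 expr1n subrr.
- by rewrite hornerD hornerN hornerXn horner_fpolyp fpolyN fpoly1 mulr1 subrr.
- move=> q sq q1 qN1.
  have -> : (fun s => s ^+ e - `|s| * s ^+ (2 * m + e) - ('X^e - fpolyp e m n).[s]) =
      residual e m n.
    by apply/funext => s; rewrite hornerD hornerN hornerXn horner_fpolyp /residual; ring.
  rewrite inner_residual_horner//; last by rewrite (leq_trans sq).
  by rewrite q1 qN1 mulr0 addr0 mul0r mulr0.
Qed.

Lemma u_residual e n j : (e <= 1)%N -> (j <= n)%N ->
  u (2 * n + 1 + e) (2 * j) = residual e (n - j) n.
Proof.
move=> e1 jn; rewrite -(@residual_proj e (n - j) n (2 * n + 1 + e)) //; [|lia|lia].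
rewrite /u; have -> : ubar (2 * n + 1 + e - 2 * j) =
   (fun s : R => s ^+ e - `|s| * s ^+ (2 * (n - j) + e)) ; last by [].
apply/funext => t; rewrite /ubar; have -> : odd (2 * n + 1 + e - 2 * j) = (e == 0)%N by lia.
have -> : (2 * n + 1 + e - 2 * j).-1 = (2 * (n - j) + e)%N by lia.
by case: e e1 => [|[|]].
Qed.

End Residual.

(** * Jacobi polynomials and r_0 *)

Section Jacobi.
Context {R : realType}.
Implicit Types (t : R) (n i k : nat) (p q : {poly R}).

Definition jacobi_weight : {poly R} := (1 - 'X) * (1 + 'X) ^+ 2.

Lemma horner_jacobi_weight t : jacobi_weight.[t] = (1 - t) * (1 + t) ^+ 2.
Proof. by rewrite hornerM horner_exp !hornerD hornerN !hornerX !hornerC. Qed.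

Lemma Rintegral_jacobi p q :
  \int[lebesgue_measure]_(x in `[-1, 1])
    (p.[x] * q.[x] * ((1 - x) `^ 1 * (1 + x) `^ 2)) =
  \int[lebesgue_measure]_(x in `[-1, 1]) (p * q * jacobi_weight).[x].
Proof.
apply: eq_Rintegral => x; rewrite inE/= in_itv/= => /andP[x1 x2].
rewrite hornerM horner_jacobi_weight hornerM powRr1 ?subr_ge0//.
by rewrite -[2]/(2%:R) powR_mulrn// -lerBlDl sub0r.
Qed.

(** The difference D of two candidates has degree below n, so it is orthogonal to itself; the
    nonnegative polynomial D^2 times the weight then has integral 0. *)
Lemma monic_jacobiE n p : p \is monic -> size p = n.+1 ->
    (forall q, (size q <= n)%N ->
      \int[lebesgue_measure]_(x in `[-1, 1]) (p * q * jacobi_weight).[x] = 0) ->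
  monic_jacobi 1 2 n = p.
Proof.
move=> mp sp orth; apply: xget_unique; first by split=> // q /orth; rewrite Rintegral_jacobi.
move=> p' [mp' sp' orth']; apply/eqP; rewrite -subr_eq0; set D := p' - p.
have sD : (size D <= n)%N.
  apply/leq_sizeP => j; rewrite leq_eqVlt coefB => /orP[/eqP <-|nj].
    move: (monicP mp) (monicP mp'); rewrite !lead_coefE sp sp' /= => -> ->.
    by rewrite subrr.
  by rewrite !nth_default ?subrr// ?sp ?sp'.
have int_horner (q : {poly R}) : (@lebesgue_measure R).-integrable `[-1, 1] (EFin \o horner q).
  by apply: continuous_integrable_itv; exact: continuous_horner.
have : D ^+ 2 * jacobi_weight = 0.
  apply: Rintegral_horner_eq0 => [t /andP[t1 t2]|].
    rewrite hornerM horner_exp horner_jacobi_weight.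
    by apply: mulr_ge0; [exact: sqr_ge0|apply: mulr_ge0; [rewrite subr_ge0|exact: sqr_ge0]].
  have := orth' _ sD; rewrite Rintegral_jacobi => i1; have i2 := orth _ sD.
  transitivity (\int[lebesgue_measure]_(x in `[-1, 1])
    ((p' * D * jacobi_weight).[x] - (p * D * jacobi_weight).[x])).
    by apply: eq_Rintegral => x _; rewrite -hornerN -hornerD -!mulrBl expr2.
  by rewrite RintegralB// i1 i2 subrr.
move=> /eqP; rewrite mulf_eq0 expf_eq0 /= => /orP[//|].
(* The weight is not the zero polynomial, since its value at 0 is 1. *)
move=> /eqP /(congr1 (fun p => p.[0])); rewrite horner_jacobi_weight horner0 subr0 addr0.
by rewrite mul1r expr1n => /eqP; rewrite oner_eq0.
Qed.

(* The coefficients d_i with sum_i d_i / (k + 3 + i) = 1 for all k <= n come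
   from the fraction 1 - prod_(k <= n) (z - k) / prod_(i <= n) (z + 3 + i). *)
Definition shift_num n : {poly R} :=
  \prod_(i < n.+1) ('X - (- (3 + i%:R))%:P) - \prod_(i < n.+1) ('X - (i%:R)%:P).

Definition shift_coef n i : R := pf_coef 3 n (shift_num n) i.

(** Both products are monic of degree n + 1; the next coefficient is the sum of the 3 + i plus the
    sum of the i. *)
Lemma shift_num_size n :
  (size (shift_num n) <= n.+1)%N /\ (shift_num n)`_n = (n%:R + 1) * (n%:R + 3).
Proof.
have sumE (f : nat -> R) : \prod_(x <- [seq f i | i <- iota 0 n.+1]) ('X - x%:P) =
    \prod_(i < n.+1) ('X - (f i)%:P).
  by rewrite big_map -[iota _ _]/(index_iota 0 n.+1) big_mkord.
have szE (f : nat -> R) : size (\prod_(i < n.+1) ('X - (f i)%:P)) = n.+2.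
  by rewrite -sumE size_prod_XsubC size_map size_iota.
have leadE (f : nat -> R) : (\prod_(i < n.+1) ('X - (f i)%:P))`_n.+1 = 1.
  have := monicP (monic_prod_XsubC [seq f i | i <- iota 0 n.+1] xpredT id).
  by rewrite sumE lead_coefE szE.
have coefE (f : nat -> R) : (\prod_(i < n.+1) ('X - (f i)%:P))`_n = - \sum_(i < n.+1) f i.
  rewrite -sumE; have := @coefPn_prod_XsubC _ [seq f i | i <- iota 0 n.+1].
  rewrite size_map size_iota => -> //.
  by rewrite big_map -[iota _ _]/(index_iota 0 n.+1) big_mkord.
split.
  apply/leq_sizeP => j; rewrite leq_eqVlt coefB => /orP[/eqP <-|nj].
    by rewrite (leadE (fun i => - (3 + i%:R))) (leadE (fun i => i%:R)) subrr.
  by rewrite !nth_default ?subrr// (szE (fun i => - (3 + i%:R)), szE (fun i => i%:R)).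
rewrite coefB (coefE (fun i => - (3 + i%:R))) (coefE (fun i => i%:R)).
rewrite sumrN big_split /= sumr_const card_ord sum_natr -[3 *+ _]mulr_natr -natr1.
by field.
Qed.

Lemma sum_shift_coef n : \sum_(i < n.+1) shift_coef n i = (n%:R + 1) * (n%:R + 3).
Proof.
have [sz <-] := shift_num_size n; exact: sum_pf_coef.
Qed.

Lemma sum_shift_coef_div n k : (k <= n)%N ->
  \sum_(i < n.+1) shift_coef n i / (k%:R + (3 + i%:R)) = 1.
Proof.
move=> kn; have [sz _] := shift_num_size n.
rewrite /shift_coef (sum_pf_coef_div sz); last first.
  by move=> i; rewrite gt_eqF// ltr_wpDl// ltr_wpDr.
rewrite /shift_num hornerD hornerN horner_prod_nodes.
rewrite [X in _ - X]horner_prod [X in _ - X](bigD1 (Ordinal (kn : k < n.+1)%N))//=.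
by rewrite hornerXsubC subrr mul0r subr0 divff// gt_eqF// pochhammer_gt0.
Qed.

(** At the node - (3 + n) the first product vanishes and the second is, up to sign, (2n + 3)! / (n +
    2)!. *)
Lemma shift_coef_lead n : shift_coef n n = (2 * n + 3)`!%:R / ((n + 2)`!%:R * n`!%:R).
Proof.
rewrite /shift_coef /pf_coef /shift_num hornerD hornerN horner_prod_nodes horner_prod_subn.
have -> : pochhammer (- (3 + n%:R) + 3) n.+1 = 0 :> R.
  by rewrite /pochhammer big_ord_recr /= (_ : _ + 3 + _ = 0) ?mulr0//; ring.
have -> : (2 * n + 3)`!%:R = (n + 2)`!%:R * pochhammer (3 + n%:R) n.+1 :> R.
  have -> : (2 * n + 3 = (n + 2) + n.+1)%N by lia.
  move: n.+1 => k; elim: k => [|k IHk]; first by rewrite addn0 pochhammer0 mulr1.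
  rewrite addnS factS natrM IHk pochhammerS -natr1 !natrD; ring.
rewrite subnn fact0 mulr1 sub0r exprS; field.
by rewrite signr_eq0 !pnatr_eq0 -!lt0n !fact_gt0.
Qed.

Definition mid : {poly R} := 2^-1 *: ('X + 1%:P).

Lemma horner_mid t : mid.[t] = (1 + t) / 2.
Proof. by rewrite hornerZ hornerD hornerX hornerC mulrC [t + 1]addrC. Qed.

Lemma size_mid : size mid = 2%N.
Proof. by rewrite size_scale ?size_XaddC// invr_neq0// pnatr_eq0. Qed.

Lemma lead_coef_mid : lead_coef mid = 2^-1.
Proof. by rewrite lead_coefZ lead_coefXaddC mulr1. Qed.

Lemma comp_midK p : (p \Po (2 *: 'X - 1%:P)) \Po mid = p.
Proof.
rewrite -comp_polyA (_ : _ \Po mid = 'X) ?comp_polyXr//.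
rewrite rmorphB /= comp_polyZ comp_polyX comp_polyC /mid scalerA.
by rewrite mulfV ?pnatr_eq0// scale1r addrK.
Qed.

Lemma inner_mid_Xn i j :
  inner (fun t : R => ((1 + t) / 2) ^+ i) (fun t => ((1 + t) / 2) ^+ j) =
  2 / ((i + j).+1)%:R.
Proof.
pose F : {poly R} := (2 / ((i + j).+1)%:R) *: mid ^+ (i + j).+1.
have -> : 2 / ((i + j).+1)%:R = F.[1] - F.[-1] :> R.
  rewrite !hornerZ !horner_exp !horner_mid subrr mul0r expr0n mulr0 subr0.
  by rewrite divff ?expr1n ?mulr1.
rewrite -Rintegral_deriv ?gtrN//; apply: eq_Rintegral => t _.
rewrite derivZ deriv_exp /= derivZ derivD derivX derivC addr0 hornerZ hornerMn hornerM.
rewrite hornerZ -polyC1 hornerC mulr1 horner_exp horner_mid -exprD.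
rewrite -[X in _ = _ * X]mulr_natl; field.
by rewrite -natrD addrC natr1 pnatr_eq0.
Qed.

Definition jacobi_shape n : {poly R} := \poly_(i < n.+1) shift_coef n i.

Lemma horner_jacobi_shape n t : (1 + t) * (jacobi_shape n \Po mid).[t] =
  \sum_(i < n.+1) (2 * shift_coef n i) * ((1 + t) / 2) ^+ i.+1.
Proof.
rewrite horner_comp horner_mid horner_poly mulr_sumr; apply: eq_bigr => i _.
by rewrite exprS; field.
Qed.

Lemma continuous_mid_Xn i : continuous (fun t : R => ((1 + t) / 2) ^+ i).
Proof.
have -> : (fun t : R => ((1 + t) / 2) ^+ i) = horner (mid ^+ i).
  by apply/funext => t; rewrite horner_exp horner_mid.
exact: continuous_horner.
Qed.

(** In powers of (1 + t)/2, the inner product with the power k + 1 is 4 times the sum of the d_i /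
    (k + 3 + i), that is 4 for each k <= n. As p(-1) = 0 excludes the constant term, the total is 4
    times the sum of the coefficients of p in this variable. *)
Lemma inner_jacobi_shape n p : (size p <= n.+2)%N -> p.[-1] = 0 ->
  inner (fun t => (1 + t) * (jacobi_shape n \Po mid).[t]) (horner p) = 4 * p.[1].
Proof.
move=> sp pN1; set p2 := p \Po (2 *: 'X - 1%:P).
have sp2 : (size p2 <= n.+2)%N.
  rewrite size_comp_poly2// size_polyDl size_scale ?pnatr_eq0 ?size_polyX//.
  by rewrite size_polyN size_poly1.
have p20 : p2`_0 = 0.
  by rewrite -horner_coef0 horner_comp !hornerE.
have p21 : p2.[1] = p.[1] by rewrite horner_comp !hornerE; congr (p.[_]); ring.
have pE : horner p = fun t => \sum_(k < n.+1) p2`_k.+1 * ((1 + t) / 2) ^+ k.+1.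
  apply/funext => t; rewrite -{1}(comp_midK p) -/p2 horner_comp horner_mid.
  by rewrite (horner_coef_wide _ sp2) big_ord_recl p20 mul0r add0r.
rewrite [in LHS]pE (_ : (fun t => _) = fun t =>
    \sum_(i < n.+1) (2 * shift_coef n i) * ((1 + t) / 2) ^+ i.+1); last by apply/funext => t; exact: horner_jacobi_shape.
rewrite innerC inner_suml; last 2 first.
- by move=> i; exact: continuous_mid_Xn.
- by apply: continuous_sum => i; apply: continuousZf; exact: continuous_mid_Xn.
rewrite -p21 (horner_coef_wide _ sp2) [in RHS]big_ord_recl p20 mul0r add0r mulr_sumr.
apply: eq_bigr => k _; rewrite expr1n mulr1 mulrC; congr (_ * _).
rewrite innerC inner_suml; last 2 first.
- by move=> i; exact: continuous_mid_Xn.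
- exact: continuous_mid_Xn.
transitivity (4 * \sum_(i < n.+1) shift_coef n i / (k%:R + (3 + i%:R))); last first.
  by rewrite sum_shift_coef_div ?mulr1// -ltnS.
rewrite mulr_sumr.
apply: eq_bigr => i _.
rewrite inner_mid_Xn addSn addnS -[((_ + _).+3)%N]addn3 !natrD; field.
by rewrite gt_eqF// ltr_wpDl// ltr_wpDr.
Qed.

Lemma shift_coef_lead_neq0 n : shift_coef n n != 0.
Proof.
by rewrite shift_coef_lead !(mulf_neq0, invr_neq0) ?pnatr_eq0 -?lt0n ?fact_gt0.
Qed.

Definition jacobi_poly n : {poly R} :=
  (2 ^+ n / shift_coef n n) *: (jacobi_shape n \Po mid).

Lemma size_jacobi_shape n : size (jacobi_shape n) = n.+1.
Proof. by rewrite size_poly_eq// shift_coef_lead_neq0. Qed.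

Lemma size_jacobi_poly n : size (jacobi_poly n) = n.+1.
Proof.
rewrite size_scale ?size_comp_poly2 ?size_jacobi_shape ?size_mid//.
by rewrite mulf_neq0 ?invr_neq0 ?shift_coef_lead_neq0// expf_neq0 ?pnatr_eq0.
Qed.

Lemma monic_jacobi_poly n : jacobi_poly n \is monic.
Proof.
rewrite monicE lead_coefZ lead_coef_comp ?size_mid// lead_coef_mid size_jacobi_shape.
rewrite lead_coefE size_jacobi_shape coef_poly ltnSn /= exprVn.
apply/eqP; field.
by rewrite shift_coef_lead_neq0 expf_neq0 ?pnatr_eq0.
Qed.

Lemma horner_jacobi_poly n t : (1 + t) * (jacobi_poly n).[t] =
  2 ^+ n / shift_coef n n * ((1 + t) * (jacobi_shape n \Po mid).[t]).
Proof. by rewrite hornerZ mulrCA. Qed.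

Lemma inner_jacobi_poly n p : (size p <= n.+2)%N -> p.[-1] = 0 -> p.[1] = 0 ->
  inner (fun t => (1 + t) * (jacobi_poly n).[t]) (horner p) = 0.
Proof.
move=> sp pN1 p1.
rewrite (_ : (fun t => _) = fun t => 2 ^+ n / shift_coef n n *
  ((1 + t) * (jacobi_shape n \Po mid).[t])); last first.
  by apply/funext => t; exact: horner_jacobi_poly.
rewrite innerZl; last 2 first.
- rewrite (_ : (fun t => _) = horner ((1 + 'X) * (jacobi_shape n \Po mid))).
    exact: continuous_horner.
  by apply/funext => t; rewrite hornerM hornerD hornerX hornerC.
- exact: continuous_horner.
by rewrite inner_jacobi_shape// p1 !mulr0.
Qed.

(** The weight splits as (1 + t) times (1 - t)(1 + t): the first factor goes with the Jacobi
    polynomial, the second makes the test polynomial vanish at both ends. *)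
Lemma monic_jacobi12 n : monic_jacobi 1 2 n = jacobi_poly n.
Proof.
apply: monic_jacobiE; [exact: monic_jacobi_poly|exact: size_jacobi_poly|move=> q sq].
rewrite -[RHS](@inner_jacobi_poly n ((1 - 'X) * (1 + 'X) * q)).
- apply: eq_Rintegral => t _.
  rewrite hornerM horner_jacobi_weight !hornerM !hornerD hornerN hornerX hornerC.
  ring.
- rewrite (leq_trans (size_polyMleq _ _))// -(subnKC (leq0n (size q))).
  have : (size ((1 - 'X) * (1 + 'X) : {poly R})%R <= 3)%N.
    rewrite (leq_trans (size_polyMleq _ _))// -[1 - 'X]opprB size_polyN.
    by rewrite size_XsubC [1 + 'X]addrC size_XaddC.
  by lia.
- by rewrite !hornerE; ring.
- by rewrite !hornerE; ring.
Qed.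

Lemma double_factorialE n : ((double_factorial (2 * n + 1)) * (2 ^ n * n`!) = (2 * n + 1)`!)%N.
Proof.
elim: n => // n IHn.
have -> : (2 * n.+1 + 1 = (2 * n + 1).+2)%N by lia.
rewrite /= -/double_factorial !factS -IHn expnS.
lia.
Qed.

(** The double factorial constant for N = n + 1 is the one that gives r_0(1) = 2, the value of 1 + t
    at 1. *)
Lemma jacobi_poly1 n :
  2 * (double_factorial (2 * n.+1 + 1))%:R / ((n.+1 + 2)`!)%:R * 2 * (jacobi_poly n).[1] = 2.
Proof.
have := double_factorialE n.+1; rewrite (_ : 2 * n.+1 + 1 = 2 * n + 3)%N; last by lia.
set df := double_factorial _ => dfE.
have df0 : df%:R != 0 :> R.
  by rewrite pnatr_eq0; apply/negP => /eqP df0; have := fact_gt0 (2 * n + 3); rewrite -dfE df0.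
rewrite hornerZ horner_comp horner_mid (_ : (1 + 1) / 2 = 1); last by field.
rewrite horner_poly; under eq_bigr do rewrite expr1n mulr1.
rewrite sum_shift_coef shift_coef_lead -dfE addSn [(n + 2).+1`!]factS [n.+1`!]factS.
rewrite !natrM natrX exprS -[(n + 2).+1%:R]natr1 natrD -[n.+1%:R]natr1.
have f0 k : k`!%:R != 0 :> R by rewrite pnatr_eq0 -lt0n fact_gt0.
have n1 : n%:R + 1 != 0 :> R by rewrite gt_eqF// ltr_wpDl.
have n3 : n%:R + 2 + 1 != 0 :> R by rewrite gt_eqF// -addrA ltr_wpDl.
field.
by rewrite !f0 n1 n3 df0 expf_neq0 ?pnatr_eq0.
Qed.

(** Subtracting the right side from 1 + t leaves a polynomial that vanishes at 1 and -1, and the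
    right side is orthogonal to all such polynomials of degree at most n + 1. *)
Lemma r0E n t : r0 n.+1 t =
  2 * (double_factorial (2 * n.+1 + 1))%:R / ((n.+1 + 2)`!)%:R * (1 + t) *
    (monic_jacobi 1 2 n).[t].
Proof.
rewrite monic_jacobi12; set C := _ / _.
have C1 : C * (2 * (jacobi_poly n).[1]) = 2 by rewrite mulrA; exact: jacobi_poly1.
set p : {poly R} := 1 + 'X - C *: ((1 + 'X) * jacobi_poly n).
have pE s : p.[s] = 1 + s - C * ((1 + s) * (jacobi_poly n).[s]).
  by rewrite hornerD hornerN hornerZ hornerM !hornerD hornerX hornerC.
rewrite /r0 (@projection_PE _ _ _ p).
- by rewrite pE; ring.
- by apply: continuousDf; [exact: cst_continuous|move=> s; exact: cvg_id].
- rewrite (leq_trans (size_polyD _ _))// geq_max size_polyN addrC size_XaddC /=.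
  rewrite (leq_trans (size_scale_leq _ _))// (leq_trans (size_polyMleq _ _))//.
  by rewrite size_XaddC size_jacobi_poly.
- by rewrite pE C1; ring.
- by rewrite pE; ring.
- move=> q sq q1 qN1.
  rewrite (_ : (fun t => _) = fun t => C * ((1 + t) * (jacobi_poly n).[t])); last first.
    by apply/funext => s; rewrite pE; ring.
  rewrite innerZl; last 2 first.
  + rewrite (_ : (fun t => _) = horner ((1 + 'X) * jacobi_poly n)).
      exact: continuous_horner.
    by apply/funext => s; rewrite hornerM hornerD hornerX hornerC.
  + exact: continuous_horner.
  by rewrite inner_jacobi_poly ?mulr0.
Qed.

End Jacobi.

(** * The Gram matrix *)

Section Coefficients.
Context {R : realType}.
Implicit Types (n e N : nat).

Lemma falling_nhalf n : falling (nhalf n) n.+1 = pochhammer (1 / 2) n.+1 :> R.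
Proof.
elim: n => [|n IHn].
  by rewrite pochhammerS pochhammer0 /falling big_ord_recl big_ord0 /nhalf /=; ring.
rewrite pochhammerS -IHn /falling [LHS]big_ord_recl mulrC; congr (_ * _).
  by apply: eq_bigr => i _; rewrite /= /bump add1n /nhalf -!natr1; ring.
by rewrite /nhalf /=; ring.
Qed.

(** A duplication formula for Pochhammer symbols; it is the source of the powers of 2 in the final
    ratio. *)
Lemma falling_nhalf_ratio n e : (e <= 1)%N ->
  falling (nhalf n) n.+1 * 2 ^+ (2 * n + 1 + e) = pochhammer (nhalf n + nhalf e) n.+1 :> R.
Proof.
move=> e1; rewrite falling_nhalf.
have -> : nhalf n + nhalf e = n%:R + 1 + e%:R :> R by rewrite /nhalf; field.
elim: n => [|n IHn].
  rewrite !pochhammerS !pochhammer0.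
  rewrite (_ : 2 * 0 + 1 + e = e.+1)%N; last by lia.
  by case: e e1 => [|[|]]// _; rewrite ?expr1 ?expr2; field.
set a := n%:R + 1 + e%:R in IHn.
have a0 : a != 0 by rewrite /a gt_eqF// -addrA ltr_wpDl// ltr_wpDr.
have -> : n.+1%:R + 1 + e%:R = a + 1 by rewrite /a -natr1; ring.
(* Multiplying by a turns (a + 1)_(n+2) into (a)_(n+3), two factors more than in the induction
   hypothesis. *)
apply: (mulfI a0); rewrite -pochhammerSl 2![in RHS]pochhammerS -IHn [in LHS]pochhammerS.
have -> : (2 * n.+1 + 1 + e = (2 * n + 1 + e) + 2)%N by lia.
rewrite exprD /a -!natr1.
by case: e e1 {IHn a0 a} => [|[|]]// _; field.
Qed.

Lemma res_normE n e : (e <= 1)%N ->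
  (n.+1)%:R * (n%:R + nhalf e) = (2 * n + 1 + e)%:R * ((2 * n + 1 + e)%:R + 1) / 4 :> R.
Proof.
by case: e => [|[|]]// _; rewrite /nhalf -[n.+1%:R]natr1 !(natrM, natrD); field.
Qed.

Lemma res_const_same n e : (e <= 1)%N ->
  res_const (nhalf e) (nhalf n) n =
  (2 ^+ (2 * n + 1 + e))^-1 / ((n.+1)%:R * (n%:R + nhalf e)) :> R.
Proof.
move=> e1; rewrite /res_const -falling_nhalf_ratio//; congr (_ / _).
have f0 : falling (nhalf n) n.+1 != 0 :> R by apply: falling_neq0; exact: nhalf_neq_nat.
field.
by rewrite f0 expf_neq0 ?pnatr_eq0.
Qed.

(** Beyond the products of [falling_nhalf_ratio] there is one more factor, -1/2, over N - 1, where N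
    = 2(n + 1) + 1 + e. With the 4 from 2^(N-2) = 2^N / 4 this makes -2 / (N - 1). *)
Lemma res_const_pred n e : (e <= 1)%N ->
  res_const (nhalf e) (nhalf n) n.+1 =
  - 2 / ((2 * n.+1 + 1 + e)%:R - 1) *
    ((2 ^+ (2 * n.+1 + 1 + e))^-1 / ((n.+2)%:R * (n.+1%:R + nhalf e))) :> R.
Proof.
move=> e1; rewrite /res_const pochhammerS -falling_nhalf_ratio//.
rewrite /falling big_ord_recr /= -/(falling (nhalf n) n.+1).
have f0 : falling (nhalf n) n.+1 != 0 :> R by apply: falling_neq0; exact: nhalf_neq_nat.
have -> : nhalf n - n.+1%:R = - (1 / 2) :> R by rewrite /nhalf -natr1; field.
have -> : nhalf n + nhalf e + n.+1%:R = (2 * n.+1 + 1 + e)%:R - 1 :> R.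
  by rewrite /nhalf !(natrM, natrD) -natr1; field.
have N0 : (2 * n.+1 + 1 + e)%:R - 1 != 0 :> R.
  by rewrite subr_eq0 pnatr_eq1; apply/negP => /eqP; lia.
have -> : (2 ^+ (2 * n.+1 + 1 + e) = 4 * 2 ^+ (2 * n + 1 + e) :> R).
  rewrite (_ : 2 * n.+1 + 1 + e = (2 * n + 1 + e) + 2)%N; last by lia.
  by rewrite (exprD _ (2 * n + 1 + e)) mulrC; congr (_ * _); ring.
rewrite mulrA; congr (_ / _).
have p0 : 2 ^+ (2 * n + 1 + e) != 0 :> R by rewrite expf_neq0 ?pnatr_eq0.
move: (_ - 1) N0 => x x0; field.
by rewrite f0 x0 p0.
Qed.

End Coefficients.

(** * Algebraic identities for the Gram form *)

Section FinalAlgebra.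
Context {R : realType}.
Implicit Types (x w al : R).

(** At x = N = 2n + 1 + e this is the factor (n + 1)(n + b) in the denominator of T, by
    [res_normE]. *)
Definition gramK x : R := x * (x + 1) / 4.

(* The inner product of w_N with itself, divided by 4^-N / gramK N. *)
Definition gramD x al : R :=
  al ^+ 2 * (1 + gramK x / (x + 1 / 2)) +
  2 * al * (- 2 / (x - 1)) * (1 + gramK x / (x - 1 / 2)) +
  (- 2 / (x - 1)) ^+ 2 * (1 + gramK x / (x - 3 / 2)).

(** Completing the square: the remainder is a positive multiple of [ta ^+ 2], because (x - 1/2)^2 -
    (x + 1/2)(x - 3/2) = 1. *)
Lemma gramD_gt0 x al : 3 <= x -> 0 < gramD x al.
Proof.
move=> x3; rewrite /gramD; set ta := - 2 / (x - 1).
have x1 : x - 1 != 0 by rewrite gt_eqF//; lra.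
have K0 : 0 < gramK x by rewrite /gramK; apply: divr_gt0; [apply: mulr_gt0; lra|lra].
have ta0 : 0 < ta ^+ 2.
  by rewrite exprn_even_gt0//= /ta mulf_neq0// ?invr_neq0// oppr_eq0 pnatr_eq0.
have -> : al ^+ 2 * (1 + gramK x / (x + 1 / 2)) +
    2 * al * ta * (1 + gramK x / (x - 1 / 2)) + ta ^+ 2 * (1 + gramK x / (x - 3 / 2)) =
  (al + ta) ^+ 2 + gramK x * ((x + 1 / 2) * (al / (x + 1 / 2) + ta / (x - 1 / 2)) ^+ 2
    + ta ^+ 2 / ((x - 1 / 2) ^+ 2 * (x - 3 / 2))).
  by field; rewrite !gt_eqF//; lra.
rewrite ltr_wpDl ?sqr_ge0// mulr_gt0// ltr_wpDl//.
  by rewrite mulr_ge0 ?sqr_ge0//; lra.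
by rewrite divr_gt0// mulr_gt0 ?exprn_gt0//; lra.
Qed.

(** The cross-multiplied form of the final ratio, with w standing for the square roots in [alpha].
    The identity splits into two rational ones, [e0] and [e1]. *)
Lemma gram_ratio x w : 3 <= x ->
    w ^+ 2 = 3 * ((2 * x + 1) * (x + 1) / ((2 * x - 3) * (x - 1))) ->
  let al := 2 / (x * (2 * x - 1)) * ((x - 2) * (2 * x + 1) / (x - 1) - 2 * w) in
  4 * (al - 2 / (x - 1)) * ((x + 1) * (x + 2)) =
  (x - 1) * ((x + 1) * (2 * x - 3) - w * ((2 * x - 3) * (x - 1))) * gramD x al.
Proof.
move=> x3 w2 al.
pose W := 3 * ((2 * x + 1) * (x + 1) / ((2 * x - 3) * (x - 1))).
rewrite -/W in w2.
pose a0 := 2 / (x * (2 * x - 1)) * ((x - 2) * (2 * x + 1) / (x - 1)).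
pose a1 := - 4 / (x * (2 * x - 1)).
pose ta := - 2 / (x - 1).
pose A := 1 + gramK x / (x + 1 / 2).
pose B := 1 + gramK x / (x - 1 / 2).
pose C := 1 + gramK x / (x - 3 / 2).
(* Both sides are reduced modulo w^2 = W to the form (_ + _ * w). *)
have alE : al = a0 + a1 * w by rewrite /al /a0 /a1; ring.
pose D0 := A * (a0 ^+ 2 + a1 ^+ 2 * W) + 2 * ta * B * a0 + ta ^+ 2 * C.
pose D1 := 2 * a1 * (A * a0 + ta * B).
have DE : gramD x al = D0 + D1 * w.
  rewrite /gramD -/A -/B -/C -/ta alE /D0 /D1 -w2; ring.
have e0 : 4 * (a0 + ta) * ((x + 1) * (x + 2)) =
    (x - 1) * (2 * x - 3) * ((x + 1) * D0 - (x - 1) * D1 * W).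
  rewrite /D0 /D1 /A /B /C /a0 /a1 /ta /W /gramK; field.
  by rewrite !gt_eqF//; lra.
have e1 : 4 * a1 * ((x + 1) * (x + 2)) =
    (x - 1) * (2 * x - 3) * ((x + 1) * D1 - (x - 1) * D0).
  rewrite /D0 /D1 /A /B /C /a0 /a1 /ta /W /gramK; field.
  by rewrite !gt_eqF//; lra.
rewrite DE alE.
transitivity (4 * (a0 + ta) * ((x + 1) * (x + 2)) + w * (4 * a1 * ((x + 1) * (x + 2)))).
  by rewrite /ta; ring.
rewrite e0 e1 -w2; ring.
Qed.

End FinalAlgebra.

Section Gram.
Context {R : realType}.
Implicit Types (n e N : nat) (al : R).

Lemma w_residual n e : (e <= 1)%N ->
  w (2 * n.+1 + 1 + e) = fun t : R =>
    alpha (2 * n.+1 + 1 + e) * residual e n.+1 n.+1 t + residual e n n.+1 t.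
Proof.
move=> e1; apply/funext => t; rewrite /w.
by rewrite (@u_residual _ e n.+1 0)// (@u_residual _ e n.+1 1)// subn0 subn1.
Qed.

Lemma continuous_w n e : (e <= 1)%N -> continuous (@w R (2 * n.+1 + 1 + e)).
Proof.
move=> e1; rewrite w_residual//.
apply: continuousDf; last exact: continuous_residual.
by apply: continuousZf; exact: continuous_residual.
Qed.

(** r_0 is a polynomial with value 2 at 1 and 0 at -1, so the half sum in [inner_residual_horner] is
    1. *)
Lemma inner_residual_r0 m n e : (e <= 1)%N ->
  inner (residual e m n) (r0 (2 * n + 1 + e)) = res_const (nhalf e) (nhalf m) n :> R.
Proof.
move=> e1; have -> : (2 * n + 1 + e = (2 * n + e).+1)%N by lia.
set C : R := 2 * (double_factorial (2 * (2 * n + e).+1 + 1))%:R / (((2 * n + e).+1 + 2)`!)%:R.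
pose p : {poly R} := C *: ((1 + 'X) * jacobi_poly (2 * n + e)).
have pE t : p.[t] = C * ((1 + t) * (jacobi_poly (2 * n + e)).[t]).
  by rewrite hornerZ hornerM hornerD hornerX hornerC.
have -> : r0 (2 * n + e).+1 = horner p.
  by apply/funext => t; rewrite r0E monic_jacobi12 pE mulrA.
rewrite inner_residual_horner//; last first.
  rewrite (leq_trans (size_scale_leq _ _))// (leq_trans (size_polyMleq _ _))//.
  by rewrite addrC size_XaddC size_jacobi_poly.
have C1 : C * ((1 + 1) * (jacobi_poly (2 * n + e)).[1]) = 2.
  by rewrite mulrA; exact: jacobi_poly1.
by rewrite !pE C1 subrr mul0r !mulr0 addr0 divff ?mulr1.
Qed.

Lemma continuous_r0 N : continuous (@r0 R N.+1).
Proof.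
have -> : @r0 R N.+1 = fun t => 2 * (double_factorial (2 * N.+1 + 1))%:R / ((N.+1 + 2)`!)%:R *
    ((1 + t) * (jacobi_poly N).[t]).
  by apply/funext => t; rewrite r0E monic_jacobi12 mulrA.
apply: continuousZf; apply: continuousMf; last exact: continuous_horner.
by apply: continuousDf; [exact: cst_continuous|move=> s; exact: cvg_id].
Qed.

Section Fixed.
Context (n e : nat) (x : R) (e1 : (e <= 1)%N).
Let N := (2 * n.+1 + 1 + e)%N.
Context (xN : N%:R = x).
Let q : R := (2 ^+ N)^-1.

Let x3 : 3 <= x.
Proof. by rewrite -xN ler_nat /N; lia. Qed.

Let K0 : gramK x != 0.
Proof. have h := x3; by rewrite /gramK gt_eqF// divr_gt0// mulr_gt0//; lra. Qed.

Let normE : n.+2%:R * (n.+1%:R + nhalf e) = gramK x.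
Proof. by rewrite /gramK -xN; exact: res_normE. Qed.

Let T0 : res_const (nhalf e) (nhalf n.+1) n.+1 = q / gramK x.
Proof. by rewrite res_const_same// normE. Qed.

Let T2 : res_const (nhalf e) (nhalf n) n.+1 = - 2 / (x - 1) * (q / gramK x).
Proof. by rewrite res_const_pred// normE -xN. Qed.

Lemma inner_w_r0 : inner (w N) (r0 N) = q / gramK x * (alpha N - 2 / (x - 1)).
Proof.
rewrite w_residual// innerDl; last 3 first.
- by apply: continuousZf; exact: continuous_residual.
- exact: continuous_residual.
- by rewrite /N addn1 addSn; exact: continuous_r0.
rewrite innerZl; last 2 first.
- exact: continuous_residual.
- by rewrite /N addn1 addSn; exact: continuous_r0.
by rewrite !inner_residual_r0// T0 T2; ring.
Qed.

Lemma inner_w_w : inner (w N) (w N) = q ^+ 2 / gramK x * gramD x (alpha N).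
Proof.
have h3 := x3.
have wE : w N = _ := w_residual n e1.
have cr m : continuous (@residual R e m n.+1) by exact: continuous_residual.
have cw : continuous (@w R N) by exact: continuous_w.
have inner_r_w m : inner (residual e m n.+1) (w N) =
    alpha N * inner (residual e n.+1 n.+1) (residual e m n.+1) +
    inner (residual e n n.+1) (residual e m n.+1) :> R.
  rewrite innerC {1}wE innerDl//; last exact: continuousZf.
  by rewrite innerZl.
rewrite {1}wE innerDl//; last exact: continuousZf.
rewrite innerZl// !inner_r_w !inner_residual_residual// T0 T2 normE.
have e00 : nhalf n.+1 + (nhalf n.+1 + nhalf e) = x + 1 / 2 :> R.
  by rewrite -xN /N /nhalf !(natrM, natrD); field.
have e01 : nhalf n + (nhalf n.+1 + nhalf e) = x - 1 / 2 :> R.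
  by rewrite -xN /N /nhalf !(natrM, natrD) -!natr1; field.
have e10 : nhalf n.+1 + (nhalf n + nhalf e) = x - 1 / 2 :> R by rewrite -e01; ring.
have e11 : nhalf n + (nhalf n + nhalf e) = x - 3 / 2 :> R.
  by rewrite -xN /N /nhalf !(natrM, natrD) -!natr1; field.
(* Since g = s + b + K, with K = [gramK x], each Gram entry is T T' K (1 + K / (s' + s + b)); the
   denominators s' + s + b were computed above. *)
have rE m m' : nhalf m' + res_root (nhalf e) (nhalf m) n.+1 =
    nhalf m' + (nhalf m + nhalf e) + gramK x.
  by rewrite -normE /res_root -!natr1; ring.
rewrite !rE e00 e01 e10 e11 /gramD; field.
by rewrite K0 !gt_eqF//; lra.
Qed.

Lemma inner_w_w_neq0 : inner (w N) (w N) != 0 :> R.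
Proof.
rewrite inner_w_w !mulf_neq0 ?invr_neq0 ?expf_neq0 ?pnatr_eq0//.
by rewrite gt_eqF// gramD_gt0.
Qed.

Lemma inner_ratio : inner (w N) (r0 N) / inner (w N) (w N) =
  2 ^+ (N - 2) *
  ((x - 1) * ((x + 1) * (2 * x - 3)
     - Num.sqrt 3 * Num.sqrt ((2 * x + 1) * (2 * x - 3) * (x - 1) * (x + 1)))
   / ((x + 1) * (x + 2))).
Proof.
have h3 := x3.
have x2 : 2 * x - 3 != 0 by rewrite gt_eqF//; lra.
have x1 : x - 1 != 0 by rewrite gt_eqF//; lra.
set W := (2 * x + 1) * (x + 1) / ((2 * x - 3) * (x - 1)).
have W0 : 0 <= W by rewrite /W divr_ge0// mulr_ge0//; lra.
pose w0 := Num.sqrt 3 * Num.sqrt W.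
have sqrtE : Num.sqrt 3 * Num.sqrt ((2 * x + 1) * (2 * x - 3) * (x - 1) * (x + 1)) =
    w0 * ((2 * x - 3) * (x - 1)) :> R.
  rewrite /w0 -[RHS]mulrA; congr (_ * _).
  (* The radicand of the theorem is that of [alpha] times a square, so both formulas share the root
     [w0]. *)
  rewrite (_ : _ * (x + 1) = W * ((2 * x - 3) * (x - 1)) ^+ 2); last first.
    by rewrite /W; field; rewrite x1 x2.
  by rewrite sqrtrM// sqrtr_sqr ger0_norm// mulr_ge0//; lra.
have w2 : w0 ^+ 2 = 3 * W by rewrite exprMn !sqr_sqrtr.
have alE : alpha N = 2 / (x * (2 * x - 1)) * ((x - 2) * (2 * x + 1) / (x - 1) - 2 * w0).
  by rewrite /alpha /= xN /w0 /W mulrA.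
have := gram_ratio x3 w2; rewrite /= -alE sqrtE inner_w_r0 inner_w_w.
have -> : 2 ^+ (N - 2) = q^-1 / 4 :> R.
  rewrite /q invrK (_ : (2 ^+ N = 2 ^+ (N - 2) * 4 :> R)) ?mulfK//.
  have -> : (4 = 2 ^+ 2 :> R) by ring.
  by rewrite -exprD subnK// /N; lia.
move=> h.
have D0 : gramD x (alpha N) != 0 by rewrite gt_eqF// gramD_gt0.
have q0 : q != 0 by rewrite invr_neq0// expf_neq0// pnatr_eq0.
have xp : (x + 1) * (x + 2) != 0 by rewrite gt_eqF// mulr_gt0//; lra.
have -> : alpha N - 2 / (x - 1) = (x - 1) * ((x + 1) * (2 * x - 3) -
    w0 * ((2 * x - 3) * (x - 1))) * gramD x (alpha N) / (4 * ((x + 1) * (x + 2))).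
  rewrite -h; field.
  by rewrite x1 !gt_eqF//; lra.
field.
by rewrite D0 q0 K0 !gt_eqF//; lra.
Qed.

End Fixed.
End Gram.

(** * The explicit formulas *)

Theorem theorem12 (R : realType) :
  (forall (n : nat) (t : R), (1 <= n)%N -> -1 <= t <= 1 ->
     w (2 * n + 1) t =
       - (1 + alpha (2 * n + 1) * t ^+ 2) * `|t| * t ^+ (2 * n - 2)
       + alpha (2 * n + 1) * fpoly 0 n n t + fpoly 0 (n - 1) n t
     /\
     w (2 * n + 2) t =
       - (1 + alpha (2 * n + 2) * t ^+ 2) * `|t| * t ^+ (2 * n - 1)
       + alpha (2 * n + 2) * fpoly 1 n n t + fpoly 1 (n - 1) n t)
  /\
  (forall n : nat, (3 <= n)%N ->
     (forall t : R, -1 <= t <= 1 ->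
        q_l0 n (- t) = q_r0 n t
        /\
        q_r0 n t =
          2 * (double_factorial (2 * n + 1))%:R / ((n + 2)`!)%:R
            * (1 + t) * (monic_jacobi 1 2 (n - 1)).[t]
          - inner (w n) (r0 n) / inner (w n) (w n) * w n t)
     /\
     inner (w n) (r0 n) / inner (w n) (w n) =
       2 ^+ (n - 2) *
       ((n%:R - 1) *
        ((n%:R + 1) * (2 * n%:R - 3)
         - Num.sqrt 3
           * Num.sqrt ((2 * n%:R + 1) * (2 * n%:R - 3)
                       * (n%:R - 1) * (n%:R + 1)))
        / ((n%:R + 1) * (n%:R + 2))) :> R).
Proof.
split=> [[|n]// t _ _|N N3].
  (* The cases e = 0 and e = 1 are the two formulas; n has been shifted by one. *)
  have wE e : (e <= 1)%N -> w (2 * n.+1 + 1 + e) t =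
      - (1 + alpha (2 * n.+1 + 1 + e) * t ^+ 2) * `|t| * t ^+ (2 * n + e)
      + alpha (2 * n.+1 + 1 + e) * fpoly e n.+1 n.+1 t + fpoly e n n.+1 t.
    move=> e1; rewrite w_residual// /residual.
    have -> : (2 * n.+1 + e = 2 + (2 * n + e))%N by lia.
    by rewrite exprD; ring.
  have := wE 0%N isT; have := wE 1%N isT.
  rewrite subn1 /= !addn0 -addnA.
  have -> : (2 * n.+1 - 2 = 2 * n)%N by lia.
  by have -> : (2 * n.+1 - 1 = 2 * n + 1)%N by lia.
(* Odd N correspond to e = 0 and even N to e = 1; the least value, n = 0 and e = 0, is N = 3. *)
have [n [e e1 NE]] : exists n, exists2 e, (e <= 1)%N & N = (2 * n.+1 + 1 + e)%N.
  by exists (N - 3)./2; exists (~~ odd N : nat); lia.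
split; last by rewrite NE; exact: (inner_ratio e1 erefl).
move=> t _; split; first by rewrite /q_l0 opprK.
rewrite /q_r0 P_lineE; last 3 first.
- by rewrite NE; exact: continuous_w.
- by case: N N3 {NE} => // N _; exact: continuous_r0.
- by rewrite NE; exact: (inner_w_w_neq0 e1 erefl).
congr (_ - _); case: N N3 {NE} => // N _; rewrite r0E.
by rewrite subn1.
Qed.
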